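(* Let $\Sigma=\Sigma_{[1/\sqrt2]}=\{(z_1,z_2)\in S^3:|z_1|=|z_2|=1/\sqrt2\}$ be the Clifford torus in the standard CR 3-sphere, parametrized by $z=\frac1{\sqrt2}(e^{i\varphi_1},e^{i\varphi_2})$, and let $F_t:\Sigma\to S^3$ be a smooth family of immersions with $F_0$ the inclusion and $\frac{d}{dt}F_t=fe_2+gT$, where $f,g$ are smooth functions. Then $$\frac{d^2}{dt^2}\Big|_{t=0}E_1(\Sigma_t)=\frac{\sqrt2}{4}\int_{\Sigma}\Big[(e_1e_1f)^2+3(e_1Tf)^2-7(e_1f)^2+9fTTf+12f^2\Big]\Theta\wedge e^1,$$ where on $\Sigma$, $e_1=-\partial_{\varphi_1}+\partial_{\varphi_2}$ and $T=\partial_{\varphi_1}+\partial_{\varphi_2}$.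
   Context: The standard CR 3-sphere $S^3\subset\mathbb{C}^2$, $z_j=x^j+iy^j$, has contact form $\Theta=\sum_{i=1}^2(x^idy^i-y^idx^i)$, Reeb field $T=\sum_i(x^i\partial_{y^i}-y^i\partial_{x^i})$, CR structure $J$ induced from $\mathbb{C}^2$; it has vanishing pseudohermitian torsion and Webster curvature $W=2$. For a surface $\Sigma_t$ in $S^3$, at nonsingular points ($T\Sigma_t\neq\xi=\ker\Theta$), $e_1$ is the unit vector (w.r.t. the Levi metric $\frac12 d\Theta(\cdot,J\cdot)$) spanning $T\Sigma_t\cap\xi$, $e_2=Je_1$, $\{e^1,e^2,\Theta\}$ is the coframe dual to $\{e_1,e_2,T\}$; the deviation function $\alpha$ is defined by $T+\alpha e_2\in T\Sigma_t$; $H$ is the $p$-mean curvature. The CR-invariant energy is $E_1(\Sigma_t)=\int_{\Sigma_t}|e_1\alpha+\frac12\alpha^2+\frac16H^2+\frac14W-\operatorname{Im}A_{11}|^{3/2}\,\Theta\wedge e^1$ (here $A_{11}=0$, $W=2$). In the variation, $e_1,e_2$ denote the corresponding fields on $\Sigma_t$. *)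

(* Defs.v *)
From Stdlib Require Import Reals List ClassicalEpsilon.
From Coquelicot Require Import Coquelicot.
Open Scope R_scope.

(** * Vectors of R^4 = C^2, coordinates (x1, y1, x2, y2), z_j = x_j + i y_j *)
Record V4 := mkV { v1 : R; v2 : R; v3 : R; v4 : R }.

Definition vadd (a b : V4) : V4 := mkV (v1 a + v1 b) (v2 a + v2 b) (v3 a + v3 b) (v4 a + v4 b).
Definition vscal (c : R) (a : V4) : V4 := mkV (c * v1 a) (c * v2 a) (c * v3 a) (c * v4 a).
Definition vsub (a b : V4) : V4 := vadd a (vscal (-1) b).
Definition vdot (a b : V4) : R := v1 a * v1 b + v2 a * v2 b + v3 a * v3 b + v4 a * v4 b.
Definition vnorm (a : V4) : R := sqrt (vdot a a).

Definition Jv (a : V4) : V4 := mkV (- v2 a) (v1 a) (- v4 a) (v3 a).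

Definition Reeb (z : V4) : V4 := Jv z.

Definition Theta (z v : V4) : R := v1 z * v2 v - v2 z * v1 v + v3 z * v4 v - v4 z * v3 v.

Definition dvec (h : R -> V4) (s : R) : V4 :=
  mkV (Derive (fun r => v1 (h r)) s) (Derive (fun r => v2 (h r)) s)
      (Derive (fun r => v3 (h r)) s) (Derive (fun r => v4 (h r)) s).

(** * Pseudohermitian geometry of a parametrized surface S : (p,q) |-> S p q in S^3.
    The Levi metric (1/2) dTheta(.,J.) is the Euclidean metric on xi. *)
Section Surf.
Variable S : R -> R -> V4.

Definition Sp (p q : R) : V4 := dvec (fun r => S r q) p.
Definition Sq (p q : R) : V4 := dvec (fun r => S p r) q.

(** A vector spanning T Sigma /\ xi is  Theta(X) Y - Theta(Y) X  (X = S_p, Y = S_q);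
    e1 is it normalized.  Coefficients of e1 in the basis (S_p, S_q): *)
Definition wvec (p q : R) : V4 :=
  vsub (vscal (Theta (S p q) (Sp p q)) (Sq p q)) (vscal (Theta (S p q) (Sq p q)) (Sp p q)).
Definition ca (p q : R) : R := - Theta (S p q) (Sq p q) / vnorm (wvec p q).
Definition cb (p q : R) : R := Theta (S p q) (Sp p q) / vnorm (wvec p q).

Definition e1 (p q : R) : V4 := vscal (/ vnorm (wvec p q)) (wvec p q).
Definition e2 (p q : R) : V4 := Jv (e1 p q).

Definition e1_fun (phi : R -> R -> R) (p q : R) : R :=
  ca p q * Derive (fun r => phi r q) p + cb p q * Derive (fun r => phi p r) q.
Definition e1_vec (Phi : R -> R -> V4) (p q : R) : V4 :=
  vadd (vscal (ca p q) (dvec (fun r => Phi r q) p)) (vscal (cb p q) (dvec (fun r => Phi p r) q)).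

Definition alpha (p q : R) : R :=
  epsilon (inhabits 0) (fun a => exists c d : R,
    vadd (Reeb (S p q)) (vscal a (e2 p q)) = vadd (vscal c (Sp p q)) (vscal d (Sq p q))).

(** p-mean curvature: nabla_{e1} e1 = H e2 for the Tanaka-Webster connection, which on
    horizontal fields of S^3 is the xi-projection of the flat derivative of R^4. *)
Definition pH (p q : R) : R := vdot (e1_vec e1 p q) (e2 p q).

(** Theta /\ e^1 evaluated on (S_p, S_q); e^1(v) = <v, e1> on T S^3. *)
Definition ThetaE1 (p q : R) : R :=
  Theta (S p q) (Sp p q) * vdot (Sq p q) (e1 p q) - Theta (S p q) (Sq p q) * vdot (Sp p q) (e1 p q).

(** integrand of E_1 with W = 2, A_11 = 0 *)
Definition E1_integrand (p q : R) : R :=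
  e1_fun alpha p q + alpha p q ^ 2 / 2 + pH p q ^ 2 / 6 + 2 / 4 - 0.

End Surf.

Definition pow32 (x : R) : R := Rabs x * sqrt (Rabs x).

(** E_1 of the surface parametrized by S over the torus [0,2pi]^2; the area element
    Theta /\ e^1 is used as a (positive) measure. *)
Definition E1_energy (S : R -> R -> V4) : R :=
  RInt (fun p => RInt (fun q => pow32 (E1_integrand S p q) * Rabs (ThetaE1 S p q)) 0 (2 * PI)) 0 (2 * PI).

Definition cliff (p q : R) : V4 :=
  mkV (cos p / sqrt 2) (sin p / sqrt 2) (cos q / sqrt 2) (sin q / sqrt 2).

Definition pd3 (i : nat) (h : R -> R -> R -> R) : R -> R -> R -> R :=
  match i with
  | O => fun t p q => Derive (fun s => h s p q) t
  | 1%nat => fun t p q => Derive (fun s => h t s q) p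
  | _ => fun t p q => Derive (fun s => h t p s) q
  end.
Definition iter_pd3 (l : list nat) (h : R -> R -> R -> R) := fold_right pd3 h l.

Definition cont3 (h : R -> R -> R -> R) (t p q : R) : Prop :=
  forall e, 0 < e -> exists d, 0 < d /\ forall t' p' q',
    Rabs (t' - t) < d -> Rabs (p' - p) < d -> Rabs (q' - q) < d ->
    Rabs (h t' p' q' - h t p q) < e.

Definition smooth3_on (eps : R) (h : R -> R -> R -> R) : Prop :=
  forall (l : list nat) (t p q : R), Rabs t < eps ->
    let k := iter_pd3 l h in
    ex_derive (fun s => k s p q) t /\ ex_derive (fun s => k t s q) p /\
    ex_derive (fun s => k t p s) q /\ cont3 k t p q.

Definition pd2 (i : nat) (h : R -> R -> R) : R -> R -> R :=
  match i with
  | O => fun p q => Derive (fun s => h s q) p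
  | _ => fun p q => Derive (fun s => h p s) q
  end.
Definition iter_pd2 (l : list nat) (h : R -> R -> R) := fold_right pd2 h l.

Definition cont2 (h : R -> R -> R) (p q : R) : Prop :=
  forall e, 0 < e -> exists d, 0 < d /\ forall p' q',
    Rabs (p' - p) < d -> Rabs (q' - q) < d -> Rabs (h p' q' - h p q) < e.

Definition smooth2 (h : R -> R -> R) : Prop :=
  forall (l : list nat) (p q : R), let k := iter_pd2 l h in
    ex_derive (fun s => k s q) p /\ ex_derive (fun s => k p s) q /\ cont2 k p q.

Definition periodic2 {A : Type} (h : R -> R -> A) : Prop :=
  forall p q, h (p + 2 * PI) q = h p q /\ h p (q + 2 * PI) = h p q.

Definition e1C (f : R -> R -> R) (p q : R) : R :=
  - Derive (fun r => f r q) p + Derive (fun r => f p r) q.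
Definition TC (f : R -> R -> R) (p q : R) : R :=
  Derive (fun r => f r q) p + Derive (fun r => f p r) q.

Definition second_var_integrand (f : R -> R -> R) (p q : R) : R :=
  (e1C (e1C f) p q) ^ 2 + 3 * (e1C (TC f) p q) ^ 2 - 7 * (e1C f p q) ^ 2
  + 9 * f p q * TC (TC f) p q + 12 * f p q ^ 2.

(* Main.v *)
(** Let E = e1, JE = e2 and write the area density as N = Theta /\ e^1 (S_p, S_q).  At the torus the
    deviation alpha and the curvature H vanish and the integrand u of E_1 is 1/2, so in the second
    derivative of u^(3/2) N the quantities alpha and H enter only through their first t-derivatives,
    except for alpha_tt, which occurs as e1 alpha_tt and integrates to zero.  The first derivatives
    follow from z_t = f e2 + g T by differentiating the orthonormality relations of the unitary frame
    (z, Jz, E, JE): on the torus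
      alpha_t = T f,   H_t = e1 e1 f + 4 f,   <E_t, JE> = g + e1 f,   [d_t, e1] = (2 f - e1 g) T,
    while N_t = - f H N + N X g for all t, where X is tangent to the surface with Theta(X) = 1 and
    e^1(X) = 0.  What remains besides the claimed integrand is a sum of e1- and T-derivatives of
    periodic functions. *)
Require Import Defs.
From Stdlib Require Import Reals List ClassicalEpsilon.
From Coquelicot Require Import Coquelicot.
From Stdlib Require Import FunctionalExtensionality Lra Lia Nsatz.
Open Scope R_scope.

(** * Functions of class C^k on the slab |t| < eps *)

(** Two obstacles precede any differentiation: |u|^(3/2) is not twice differentiable where u
    vanishes, and alpha is only defined by a choice operator. Since W = 2 makes u = 1/2 on the
    torus, compactness gives a slab |t| < d on which u > 0, and there |u|^(3/2) = u sqrt u is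
    smooth. Tangency of T + alpha e2 is a linear system of determinant N, so alpha equals a quotient
    built from first derivatives of F and from e1, with denominator N. The equation F_t = f e2 + g T
    holds for all small t with the moving e2, and not only at t = 0. This is what determines N_tt:
    the formula for N_t is an identity in t and is differentiated once more. No second t-derivative
    of the frame is ever computed. The factor sqrt 2 / 4 is u^(1/2) / 2 at u = 1/2; the remaining
    1/2 is the coefficient (3/2)(1/3) of (e1 e1 f)^2, which comes from 3/2 u^(1/2) u_tt and the term
    H^2/6 of u. *)

Definition slice (i : nat) (h : R -> R -> R -> R) (t p q : R) : R -> R :=
  match i with
  | O => fun s => h s p q
  | 1%nat => fun s => h t s q
  | _ => fun s => h t p s
  end.

Definition coord (i : nat) (t p q : R) : R :=
  match i with O => t | 1%nat => p | _ => q end.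

(** Finite order is tracked because closure under products, inverses and roots goes by induction on
    n; smoothness is then [Ck] for every n. Only t is restricted, so the domain is an open slab,
    invariant under translations in p and q. *)
Fixpoint Ck (eps : R) (n : nat) (h : R -> R -> R -> R) : Prop :=
  (forall t p q, Rabs t < eps -> cont3 h t p q) /\
  match n with
  | O => True
  | S m => (forall i t p q, Rabs t < eps -> ex_derive (slice i h t p q) (coord i t p q)) /\
           (forall i, Ck eps m (pd3 i h))
  end.

(** One-variable rules for [Derive] can thus be applied to all three directions at once. Every index
    from 2 on stands for q, as in [pd3]. *)
Lemma pd3_slice i h t p q : pd3 i h t p q = Derive (slice i h t p q) (coord i t p q).
Proof. destruct i as [|[|i]]; reflexivity. Qed.

Lemma slice_coord i h t p q : slice i h t p q (coord i t p q) = h t p q.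
Proof. destruct i as [|[|i]]; reflexivity. Qed.

Lemma Ck_cont eps n h t p q : Ck eps n h -> Rabs t < eps -> cont3 h t p q.
Proof. destruct n; intros [H _]; apply H. Qed.

Lemma Ck_pd eps n h i : Ck eps (S n) h -> Ck eps n (pd3 i h).
Proof. intros [_ [_ H]]; apply H. Qed.

Lemma Ck_ex eps n h i t p q : Ck eps (S n) h -> Rabs t < eps ->
  ex_derive (slice i h t p q) (coord i t p q).
Proof. intros [_ [H _]]; apply H. Qed.

Lemma Ck_is eps n h i t p q : Ck eps (S n) h -> Rabs t < eps ->
  is_derive (slice i h t p q) (coord i t p q) (pd3 i h t p q).
Proof.
  intros H Ht; rewrite pd3_slice; apply Derive_correct; exact (Ck_ex _ _ _ _ _ _ _ H Ht).
Qed.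

Lemma Ck_S eps n h : Ck eps (S n) h -> Ck eps n h.
Proof.
  revert h; induction n as [|n IH]; intros h H.
  - split; [intros; now apply (Ck_cont eps 1)|exact I].
  - split; [intros; now apply (Ck_cont eps (S (S n)))|split].
    + intros; now apply (Ck_ex eps (S n)).
    + intros i; apply IH, Ck_pd, H.
Qed.

Lemma Ck_le eps n m h : (m <= n)%nat -> Ck eps n h -> Ck eps m h.
Proof. induction 1; auto using Ck_S. Qed.

Lemma Ck_shrink eps d n h : d <= eps -> Ck eps n h -> Ck d n h.
Proof.
  intros Hd; revert h; induction n as [|n IH]; intros h H.
  - split; [intros; apply (Ck_cont eps 0); auto; lra|exact I].
  - split; [intros; apply (Ck_cont eps (S n)); auto; lra|split].
    + intros; apply (Ck_ex eps n); auto; lra.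
    + intros i; apply IH, Ck_pd, H.
Qed.

Lemma slab_locally eps t : Rabs t < eps -> locally t (fun s => Rabs s < eps).
Proof.
  intros Ht. assert (Hp : 0 < eps - Rabs t) by lra.
  exists (mkposreal _ Hp); intros s Hs.
  change (Rabs (s - t) < eps - Rabs t) in Hs.
  replace s with (s - t + t) by ring.
  eapply Rle_lt_trans; [apply Rabs_triang|lra].
Qed.

Lemma slice_ext eps h k i t p q :
  (forall t p q, Rabs t < eps -> h t p q = k t p q) -> Rabs t < eps ->
  locally (coord i t p q) (fun s => slice i h t p q s = slice i k t p q s).
Proof.
  intros E Ht; destruct i as [|[|i]]; simpl.
  - refine (filter_imp _ _ _ (slab_locally _ _ Ht)); intros s Hs; now apply E.
  - apply filter_forall; intros; now apply E.
  - apply filter_forall; intros; now apply E.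
Qed.

Lemma pd3_ext eps h k i t p q :
  (forall t p q, Rabs t < eps -> h t p q = k t p q) -> Rabs t < eps ->
  pd3 i h t p q = pd3 i k t p q.
Proof.
  intros E Ht; rewrite !pd3_slice; apply Derive_ext_loc, (slice_ext eps); auto.
Qed.

Lemma cont3_ext_loc eps h k t p q :
  (forall t p q, Rabs t < eps -> h t p q = k t p q) -> Rabs t < eps ->
  cont3 h t p q -> cont3 k t p q.
Proof.
  intros E Ht H e He; destruct (H e He) as [d [Hd H1]].
  destruct (slab_locally _ _ Ht) as [d2 Hd2].
  exists (Rmin d d2); split; [apply Rmin_pos; [auto|apply cond_pos]|].
  intros t' p' q' A B C.
  pose proof (Rmin_l d d2); pose proof (Rmin_r d d2).
  rewrite <- !E; auto; [apply H1; lra|].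
  apply Hd2. change (Rabs (t' - t) < d2). lra.
Qed.

(** The slab is open in t, so equality on it passes to all derivatives. Quantities with an opaque
    definition, such as [alpha], become regular by way of a formula valid on the slab. *)
Lemma Ck_ext eps n h k : (forall t p q, Rabs t < eps -> h t p q = k t p q) ->
  Ck eps n h -> Ck eps n k.
Proof.
  revert h k; induction n as [|n IH]; intros h k E H.
  - split; [intros; apply (cont3_ext_loc eps h); auto; now apply (Ck_cont eps 0)|exact I].
  - split; [|split].
    + intros; apply (cont3_ext_loc eps h); auto; now apply (Ck_cont eps (S n)).
    + intros; refine (ex_derive_ext_loc _ _ _ _ (Ck_ex eps n h i t p q H _)); auto.
      apply (slice_ext eps); auto.
    + intros i; apply (IH (pd3 i h)); [|apply Ck_pd, H].
      intros; apply (pd3_ext eps); auto.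
Qed.

Lemma smooth3_Ck eps n h : smooth3_on eps h -> Ck eps n h.
Proof.
  revert h; induction n as [|n IH]; intros h H.
  - split; [intros; apply (H nil t p q); auto|exact I].
  - split; [intros; apply (H nil t p q); auto|split].
    + intros i t p q Ht; destruct (H nil t p q Ht) as [A [B [C _]]].
      destruct i as [|[|i]]; assumption.
    + intros i; apply IH; intros l t p q Ht.
      replace (iter_pd3 l (pd3 i h)) with (iter_pd3 (l ++ i :: nil) h)
        by (unfold iter_pd3; rewrite fold_right_app; reflexivity).
      apply H; auto.
Qed.

(** * Closure of the class C^n under algebraic operations, inverses and square roots *)

Lemma Ck_const eps n c : Ck eps n (fun _ _ _ => c).
Proof.
  revert c; induction n as [|n IH]; intros c.
  - split; [|exact I]. intros t p q _ e He; exists 1; split; [lra|].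
    intros; rewrite Rminus_diag, Rabs_R0; auto.
  - split; [|split].
    + intros; now apply (Ck_cont eps n).
    + intros i t p q _; destruct i as [|[|i]]; apply ex_derive_const.
    + intros i; apply (Ck_ext eps n (fun _ _ _ => 0)); [|apply IH].
      intros; rewrite pd3_slice; destruct i as [|[|i]]; simpl; now rewrite Derive_const.
Qed.

(** Functions on the torus are treated as functions constant in t, so that f, g and the values at t
    = 0 share one calculus with the moving quantities. *)
Definition lift2 (h : R -> R -> R) : R -> R -> R -> R := fun _ p q => h p q.

Lemma pd3_lift2_t h t p q : pd3 0 (lift2 h) t p q = 0.
Proof. exact (Derive_const (h p q) t). Qed.

Lemma smooth2_pd h i : smooth2 h -> smooth2 (pd2 i h).
Proof.
  intros H l p q.
  replace (iter_pd2 l (pd2 i h)) with (iter_pd2 (l ++ i :: nil) h)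
    by (unfold iter_pd2; rewrite fold_right_app; reflexivity).
  apply H.
Qed.

Lemma smooth2_Ck eps n h : smooth2 h -> Ck eps n (lift2 h).
Proof.
  revert h; induction n as [|n IH]; intros h H.
  - split; [|exact I]. intros t p q _ e He.
    destruct (H nil p q) as [_ [_ C]]; destruct (C e He) as [d [Hd C1]].
    exists d; split; auto; intros; apply C1; auto.
  - split; [|split].
    + intros; apply (Ck_cont eps n); auto.
    + intros i t p q _; destruct (H nil p q) as [A [B _]].
      destruct i as [|[|i]]; [apply ex_derive_const|exact A|exact B].
    + intros [|[|i]].
      * apply (Ck_ext eps n (fun _ _ _ => 0)); [|apply Ck_const].
        intros; now rewrite pd3_lift2_t.
      * exact (IH _ (smooth2_pd h 0 H)).
      * exact (IH _ (smooth2_pd h 1 H)).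
Qed.

(** Needed for the second t-derivative of alpha at t = 0, which is integrated over the torus as a
    function of p and q alone. *)
Lemma Ck_freeze eps n h t : Rabs t < eps -> Ck eps n h -> Ck eps n (lift2 (h t)).
Proof.
  intros Ht; revert h; induction n as [|n IH]; intros h H.
  - split; [|exact I]. intros s p q _ e He.
    destruct (Ck_cont _ _ _ t p q H Ht e He) as [d [Hd C]].
    exists d; split; auto; intros; apply C; auto; rewrite Rminus_diag, Rabs_R0; auto.
  - split; [|split].
    + intros; apply (Ck_cont eps n); auto. apply IH; now apply Ck_S.
    + intros i s p q _; pose proof (Ck_ex _ _ _ i t p q H Ht).
      destruct i as [|[|i]]; [apply ex_derive_const|assumption|assumption].
    + intros i; pose proof (IH _ (Ck_pd _ _ _ i H)) as D; destruct i as [|[|i]]; [|exact D|exact D].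
      apply (Ck_ext eps n (fun _ _ _ => 0)); [|apply Ck_const].
      intros; now rewrite pd3_lift2_t.
Qed.

(** On the product space, continuity of sums, products and compositions is available for filters. *)
Definition uncurry3 (h : R -> R -> R -> R) (x : R * R * R) : R := h (fst (fst x)) (snd (fst x)) (snd x).

Lemma cont3_continuous h t p q : cont3 h t p q <-> continuous (uncurry3 h) (t, p, q).
Proof.
  split.
  - intros H; apply filterlim_locally; intros e.
    destruct (H e (cond_pos e)) as [d [Hd H1]].
    exists (mkposreal d Hd); intros [[t' p'] q'] [[A B] C]; apply H1; auto.
  - intros H e He.
    destruct (proj1 (filterlim_locally _ _) H (mkposreal e He)) as [d Hd].
    exists d; split; [apply cond_pos|]; intros t' p' q' A B C.
    apply (Hd (t', p', q')); repeat split; auto.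
Qed.

Lemma pd3_plus eps h k i t p q : Ck eps 1 h -> Ck eps 1 k -> Rabs t < eps ->
  pd3 i (fun t p q => h t p q + k t p q) t p q = pd3 i h t p q + pd3 i k t p q.
Proof.
  intros H K Ht.
  pose proof (Derive_plus _ _ _ (Ck_ex _ _ _ i t p q H Ht) (Ck_ex _ _ _ i t p q K Ht)).
  destruct i as [|[|i]]; assumption.
Qed.

Lemma pd3_mult eps h k i t p q : Ck eps 1 h -> Ck eps 1 k -> Rabs t < eps ->
  pd3 i (fun t p q => h t p q * k t p q) t p q =
  pd3 i h t p q * k t p q + h t p q * pd3 i k t p q.
Proof.
  intros H K Ht.
  pose proof (Derive_mult _ _ _ (Ck_ex _ _ _ i t p q H Ht) (Ck_ex _ _ _ i t p q K Ht)).
  destruct i as [|[|i]]; assumption.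
Qed.

Lemma Ck_plus eps n h k : Ck eps n h -> Ck eps n k -> Ck eps n (fun t p q => h t p q + k t p q).
Proof.
  revert h k; induction n as [|n IH]; intros h k H K.
  - split; [|exact I]. intros; apply cont3_continuous.
    apply (continuous_plus (uncurry3 h) (uncurry3 k)); apply cont3_continuous; eapply Ck_cont; eauto.
  - split; [|split].
    + intros; apply (Ck_cont eps n); auto. apply IH; now apply Ck_S.
    + intros i t p q Ht.
      pose proof (ex_derive_plus _ _ _ (Ck_ex _ _ _ i t p q H Ht) (Ck_ex _ _ _ i t p q K Ht)).
      destruct i as [|[|i]]; assumption.
    + intros i; apply (Ck_ext eps n (fun t p q => pd3 i h t p q + pd3 i k t p q)).
      * intros t p q Ht; symmetry; apply (pd3_plus eps); auto; apply (Ck_le eps (S n)); auto; lia.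
      * apply IH; now apply Ck_pd.
Qed.

Lemma Ck_mult eps n h k : Ck eps n h -> Ck eps n k -> Ck eps n (fun t p q => h t p q * k t p q).
Proof.
  revert h k; induction n as [|n IH]; intros h k H K.
  - split; [|exact I]. intros; apply cont3_continuous.
    apply (continuous_mult (uncurry3 h) (uncurry3 k)); apply cont3_continuous; eapply Ck_cont; eauto.
  - split; [|split].
    + intros; apply (Ck_cont eps n); auto. apply IH; now apply Ck_S.
    + intros i t p q Ht.
      pose proof (ex_derive_mult _ _ _ (Ck_ex _ _ _ i t p q H Ht) (Ck_ex _ _ _ i t p q K Ht)).
      destruct i as [|[|i]]; assumption.
    + intros i; apply (Ck_ext eps n (fun t p q => pd3 i h t p q * k t p q + h t p q * pd3 i k t p q)).
      * intros t p q Ht; symmetry; apply (pd3_mult eps); auto; apply (Ck_le eps (S n)); auto; lia.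
      * apply Ck_plus; apply IH; auto using Ck_pd, Ck_S.
Qed.

Lemma Ck_opp eps n h : Ck eps n h -> Ck eps n (fun t p q => - h t p q).
Proof.
  intros H; apply (Ck_ext eps n (fun t p q => -1 * h t p q)); [intros; ring|].
  apply Ck_mult; auto; apply Ck_const.
Qed.

Lemma Ck_minus eps n h k : Ck eps n h -> Ck eps n k -> Ck eps n (fun t p q => h t p q - k t p q).
Proof. intros H K; apply Ck_plus; auto; now apply Ck_opp. Qed.

Lemma Ck_pow eps n h m : Ck eps n h -> Ck eps n (fun t p q => h t p q ^ m).
Proof.
  intros H; induction m as [|m IH]; [apply (Ck_const eps n 1)|now apply (Ck_mult eps n h)].
Qed.

(** The derivative - h_i (1/h)(1/h) is a product of h_i and of 1/h itself at one order less, which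
    the induction hypothesis covers. *)
Lemma Ck_inv eps n h : (forall t p q, Rabs t < eps -> h t p q <> 0) ->
  Ck eps n h -> Ck eps n (fun t p q => / h t p q).
Proof.
  intros Hn; induction n as [|n IH]; intros H.
  - split; [|exact I]. intros; apply cont3_continuous.
    apply (continuous_comp (uncurry3 h) Rinv).
    + apply cont3_continuous; eapply Ck_cont; eauto.
    + apply continuous_Rinv; now apply Hn.
  - split; [|split].
    + intros; apply (Ck_cont eps n); auto. apply IH; now apply Ck_S.
    + intros i t p q Ht. pose proof (Hn t p q Ht) as Hz; rewrite <- (slice_coord i) in Hz.
      pose proof (ex_derive_inv _ _ (Ck_ex _ _ _ i t p q H Ht) Hz).
      destruct i as [|[|i]]; assumption.
    + intros i; apply (Ck_ext eps n (fun t p q => - pd3 i h t p q * (/ h t p q * / h t p q))).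
      * intros t p q Ht. pose proof (Ck_ex _ _ _ i t p q H Ht).
        pose proof (Hn t p q Ht).
        rewrite pd3_slice with (h := fun t p q => / h t p q), pd3_slice.
        transitivity (- Derive (slice i h t p q) (coord i t p q) / (slice i h t p q (coord i t p q)) ^ 2).
        { rewrite slice_coord; field; auto. }
        rewrite <- (slice_coord i) in H1.
        pose proof (Derive_inv _ _ H0 H1).
        symmetry; destruct i as [|[|i]]; assumption.
      * apply Ck_mult; [apply Ck_opp, Ck_pd, H|apply Ck_mult; apply IH, Ck_S, H].
Qed.

Lemma Ck_div eps n h k : (forall t p q, Rabs t < eps -> k t p q <> 0) ->
  Ck eps n h -> Ck eps n k -> Ck eps n (fun t p q => h t p q / k t p q).
Proof. intros; apply Ck_mult; auto; now apply Ck_inv. Qed.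

(** As for the inverse: the derivative h_i / (2 sqrt h) involves only h_i and the root at one order
    less. *)
Lemma Ck_sqrt eps n h : (forall t p q, Rabs t < eps -> 0 < h t p q) ->
  Ck eps n h -> Ck eps n (fun t p q => sqrt (h t p q)).
Proof.
  intros Hn; induction n as [|n IH]; intros H.
  - split; [|exact I]. intros; apply cont3_continuous.
    apply (continuous_comp (uncurry3 h) sqrt).
    + apply cont3_continuous; eapply Ck_cont; eauto.
    + apply continuous_sqrt.
  - assert (D : forall i t p q, Rabs t < eps ->
      is_derive (slice i (fun t p q => sqrt (h t p q)) t p q) (coord i t p q)
        (pd3 i h t p q * / (2 * sqrt (h t p q)))).
    { intros i t p q Ht. pose proof (Hn t p q Ht) as Hz; rewrite <- (slice_coord i) in Hz.
      pose proof (is_derive_sqrt _ _ _ (Ck_is _ _ _ i t p q H Ht) Hz) as E.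
      destruct i as [|[|i]]; exact E. }
    split; [|split].
    + intros; apply (Ck_cont eps n); auto. apply IH; now apply Ck_S.
    + intros i t p q Ht. eexists; now apply D.
    + intros i; apply (Ck_ext eps n (fun t p q => pd3 i h t p q * / (2 * sqrt (h t p q)))).
      * intros t p q Ht. rewrite pd3_slice with (h := fun t p q => sqrt (h t p q)).
        symmetry; apply is_derive_unique; now apply D.
      * apply Ck_mult; [apply Ck_pd, H|apply Ck_inv].
        -- intros t p q Ht. pose proof (sqrt_lt_R0 _ (Hn t p q Ht)). lra.
        -- apply Ck_mult; [apply Ck_const|apply IH, Ck_S, H].
Qed.

(** * Symmetry of mixed partial derivatives and second t-derivatives *)

Lemma cont3_tp h t p q : cont3 h t p q -> continuity_2d_pt (fun a b => h a b q) t p.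
Proof.
  intros H e; destruct (H e (cond_pos e)) as [d [Hd H1]].
  exists (mkposreal d Hd); intros; apply H1; auto; rewrite Rminus_diag, Rabs_R0; auto.
Qed.

Lemma cont3_tq h t p q : cont3 h t p q -> continuity_2d_pt (fun a b => h a p b) t q.
Proof.
  intros H e; destruct (H e (cond_pos e)) as [d [Hd H1]].
  exists (mkposreal d Hd); intros; apply H1; auto; rewrite Rminus_diag, Rabs_R0; auto.
Qed.

Lemma cont3_pq h t p q : cont3 h t p q -> continuity_2d_pt (fun a b => h t a b) p q.
Proof.
  intros H e; destruct (H e (cond_pos e)) as [d [Hd H1]].
  exists (mkposreal d Hd); intros; apply H1; auto; rewrite Rminus_diag, Rabs_R0; auto.
Qed.

Lemma locally_2d_slab (P : R -> R -> Prop) eps t x : Rabs t < eps ->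
  (forall s y, Rabs s < eps -> P s y) -> locally_2d P t x.
Proof.
  intros Ht H; destruct (slab_locally _ _ Ht) as [d Hd].
  exists d; intros; apply H; now apply Hd.
Qed.

Lemma pd3_comm_t eps h i t p q : Ck eps 2 h -> Rabs t < eps ->
  pd3 0 (pd3 i h) t p q = pd3 i (pd3 0 h) t p q.
Proof.
  intros H Ht.
  pose proof (fun i => Ck_pd _ _ _ i H) as H1.
  destruct i as [|[|i]]; [reflexivity| |].
  - apply (Schwarz (fun a b => h a b q)).
    + apply (locally_2d_slab _ eps); auto; intros s y Hs; repeat split.
      * exact (Ck_ex _ _ _ 0 s y q H Hs).
      * exact (Ck_ex _ _ _ 1 s y q H Hs).
      * exact (Ck_ex _ _ _ 0 s y q (H1 1%nat) Hs).
      * exact (Ck_ex _ _ _ 1 s y q (H1 0%nat) Hs).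
    + apply (cont3_tp (pd3 0 (pd3 1 h))); apply (Ck_cont eps 0); auto; now apply Ck_pd.
    + apply (cont3_tp (pd3 1 (pd3 0 h))); apply (Ck_cont eps 0); auto; now apply Ck_pd.
  - apply (Schwarz (fun a b => h a p b)).
    + apply (locally_2d_slab _ eps); auto; intros s y Hs; repeat split.
      * exact (Ck_ex _ _ _ 0 s p y H Hs).
      * exact (Ck_ex _ _ _ 2 s p y H Hs).
      * exact (Ck_ex _ _ _ 0 s p y (H1 2%nat) Hs).
      * exact (Ck_ex _ _ _ 2 s p y (H1 0%nat) Hs).
    + apply (cont3_tq (pd3 0 (pd3 2 h))); apply (Ck_cont eps 0); auto; now apply Ck_pd.
    + apply (cont3_tq (pd3 2 (pd3 0 h))); apply (Ck_cont eps 0); auto; now apply Ck_pd.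
Qed.

Lemma pd3_comm_pq eps h t p q : Ck eps 2 h -> Rabs t < eps ->
  pd3 1 (pd3 2 h) t p q = pd3 2 (pd3 1 h) t p q.
Proof.
  intros H Ht. pose proof (fun i => Ck_pd _ _ _ i H) as H1.
  apply (Schwarz (fun a b => h t a b)).
  - exists (mkposreal 1 Rlt_0_1); intros x y _ _; repeat split.
    + exact (Ck_ex _ _ _ 1 t x y H Ht).
    + exact (Ck_ex _ _ _ 2 t x y H Ht).
    + exact (Ck_ex _ _ _ 1 t x y (H1 2%nat) Ht).
    + exact (Ck_ex _ _ _ 2 t x y (H1 1%nat) Ht).
  - apply (cont3_pq (pd3 1 (pd3 2 h))); apply (Ck_cont eps 0); auto; now apply Ck_pd.
  - apply (cont3_pq (pd3 2 (pd3 1 h))); apply (Ck_cont eps 0); auto; now apply Ck_pd.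
Qed.

Lemma pd3_mult_tt eps h k t p q : Ck eps 2 h -> Ck eps 2 k -> Rabs t < eps ->
  pd3 0 (pd3 0 (fun t p q => h t p q * k t p q)) t p q =
  pd3 0 (pd3 0 h) t p q * k t p q + 2 * (pd3 0 h t p q * pd3 0 k t p q) + h t p q * pd3 0 (pd3 0 k) t p q.
Proof.
  intros Hh Hk Ht.
  rewrite (pd3_ext eps _ (fun t p q => pd3 0 h t p q * k t p q + h t p q * pd3 0 k t p q))
    by (auto; intros; apply (pd3_mult eps); auto using Ck_S).
  rewrite (pd3_plus eps), !(pd3_mult eps) by auto using Ck_mult, Ck_S, Ck_pd. ring.
Qed.

Lemma pd3_plus_tt eps h k t p q : Ck eps 2 h -> Ck eps 2 k -> Rabs t < eps ->
  pd3 0 (pd3 0 (fun t p q => h t p q + k t p q)) t p q =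
  pd3 0 (pd3 0 h) t p q + pd3 0 (pd3 0 k) t p q.
Proof.
  intros Hh Hk Ht.
  rewrite (pd3_ext eps _ (fun t p q => pd3 0 h t p q + pd3 0 k t p q))
    by (auto; intros; apply (pd3_plus eps); auto using Ck_S).
  now rewrite (pd3_plus eps) by auto using Ck_pd.
Qed.

Lemma pd3_const c t p q : pd3 0 (fun _ _ _ => c) t p q = 0.
Proof. exact (Derive_const c t). Qed.

(** * Integration over the torus *)

Definition torus_int (h : R -> R -> R) : R :=
  RInt (fun p => RInt (fun q => h p q) 0 (2 * PI)) 0 (2 * PI).

Lemma cont2d_snd (h : R -> R -> R) x y : continuity_2d_pt h x y -> continuous (fun b => h x b) y.
Proof.
  intros H; apply filterlim_locally; intros e; destruct (H e) as [d Hd].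
  exists d; intros a Ha; apply Hd; [rewrite Rminus_diag, Rabs_R0; apply cond_pos|exact Ha].
Qed.

Lemma Ck_continuous_q eps n h t p q : Ck eps n h -> Rabs t < eps -> continuous (fun q => h t p q) q.
Proof.
  intros H Ht; apply (cont2d_snd (fun a b => h a p b)), cont3_tq; now apply (Ck_cont eps n).
Qed.

Lemma Ck_ex_RInt_q eps n h t p a b : Ck eps n h -> Rabs t < eps -> ex_RInt (fun q => h t p q) a b.
Proof.
  intros H Ht; apply (ex_RInt_continuous (V := R_CompleteNormedModule)); intros.
  now apply (Ck_continuous_q eps n).
Qed.

(** Compactness of [a, b] replaces the radii of continuity at the points (t, p, q) by a single one,
    so the integrand varies uniformly in q. *)
Lemma continuity_2d_RInt eps n h t p a b : a <= b -> Ck eps n h -> Rabs t < eps ->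
  continuity_2d_pt (fun t p => RInt (fun q => h t p q) a b) t p.
Proof.
  intros Hab H Ht e.
  (* The uniform variation is at most 2 e', since two estimates meet at a centre of the cover; the
     summand 1 keeps the denominator positive when a = b. *)
  set (e' := e / (2 * (b - a) + 1)).
  assert (He' : 0 < e') by (apply Rdiv_lt_0_compat; [apply cond_pos|lra]).
  assert (C : forall q, {d : posreal | forall t' p' q', Rabs (t' - t) < d ->
    Rabs (p' - p) < d -> Rabs (q' - q) < d -> Rabs (h t' p' q' - h t p q) < e'}).
  { intros q; apply constructive_indefinite_description.
    destruct (Ck_cont _ _ _ t p q H Ht e' He') as [d [Hd H1]].
    now exists (mkposreal d Hd). }
  destruct (compactness_value_1d a b (fun q => proj1_sig (C q))) as [d Hd].
  destruct (slab_locally _ _ Ht) as [d2 Hd2].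
  assert (Hm : 0 < Rmin d d2) by (apply Rmin_pos; apply cond_pos).
  exists (mkposreal _ Hm); simpl; intros t' p' A B.
  pose proof (Rmin_l d d2) as M1; pose proof (Rmin_r d d2) as M2.
  assert (Ht' : Rabs t' < eps) by (apply Hd2; change (Rabs (t' - t) < d2); lra).
  assert (U : forall q, a <= q <= b -> Rabs (h t' p' q - h t p q) <= 2 * e').
  (* Compactness yields the centre s near q only under a double negation, hence the argument by
     contradiction. *)
  { intros q Hq. apply Rnot_lt_le; intros Hc. apply (Hd q Hq); intros [s [Hs [Hs1 Hs2]]].
    destruct (C s) as [ds Hds]; simpl in *.
    pose proof (Hds t' p' q ltac:(lra) ltac:(lra) Hs1) as X1.
    assert (X2 : Rabs (h t p q - h t p s) < e').
    { apply Hds; auto; rewrite Rminus_diag, Rabs_R0; apply cond_pos. }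
    pose proof (Rabs_triang (h t' p' q - h t p s) (- (h t p q - h t p s))) as X3.
    rewrite Rabs_Ropp in X3.
    replace (h t' p' q - h t p s + - (h t p q - h t p s)) with (h t' p' q - h t p q) in X3 by ring.
    lra. }
  pose proof (Ck_ex_RInt_q _ _ _ t p a b H Ht) as I1.
  pose proof (Ck_ex_RInt_q _ _ _ t' p' a b H Ht') as I2.
  assert (E : RInt (fun q => h t' p' q - h t p q) a b
    = RInt (fun q => h t' p' q) a b - RInt (fun q => h t p q) a b)
    by now apply (RInt_minus (V := R_CompleteNormedModule)).
  rewrite <- E.
  apply Rle_lt_trans with ((b - a) * (2 * e')).
  - apply abs_RInt_le_const; auto. now apply (ex_RInt_minus (V := R_NormedModule)).
  - unfold e'. pose proof (cond_pos e) as Hp.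
    apply (Rmult_lt_reg_r (2 * (b - a) + 1)); [lra|].
    replace ((b - a) * (2 * (e / (2 * (b - a) + 1))) * (2 * (b - a) + 1))
      with (2 * (b - a) * e) by (field; lra).
    nra.
Qed.

Lemma Ck_ex_RInt_pq eps n h t : Ck eps n h -> Rabs t < eps ->
  ex_RInt (fun p => RInt (fun q => h t p q) 0 (2 * PI)) 0 (2 * PI).
Proof.
  intros H Ht; apply (ex_RInt_continuous (V := R_CompleteNormedModule)); intros p _.
  pose proof PI_RGT_0.
  apply (cont2d_snd (fun t p => RInt (fun q => h t p q) 0 (2 * PI))).
  apply (continuity_2d_RInt eps n); auto; lra.
Qed.

(** The bound i < 2 leaves out the direction q of integration; the 0 in the third slot is a dummy
    coordinate. *)
Lemma is_derive_RInt_q i eps h t p : (i < 2)%nat -> Ck eps 1 h -> Rabs t < eps ->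
  is_derive (slice i (fun t p _ => RInt (fun q => h t p q) 0 (2 * PI)) t p 0) (coord i t p 0)
    (RInt (fun q => pd3 i h t p q) 0 (2 * PI)).
Proof.
  intros Hi H Ht. destruct i as [|[|i]]; [| |lia].
  - apply (is_derive_RInt_param (fun s q => h s p q)).
    + refine (filter_imp _ _ _ (slab_locally _ _ Ht)); intros s Hs q _.
      exact (Ck_ex _ _ _ 0 s p q H Hs).
    + intros q _; apply (cont3_tq (pd3 0 h)); apply (Ck_cont eps 0); auto; now apply Ck_pd.
    + refine (filter_imp _ _ _ (slab_locally _ _ Ht)); intros s Hs.
      now apply (Ck_ex_RInt_q eps 1).
  - apply (is_derive_RInt_param (fun s q => h t s q)).
    + apply filter_forall; intros s q _. exact (Ck_ex _ _ _ 1 t s q H Ht).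
    + intros q _; apply (cont3_pq (pd3 1 h)); apply (Ck_cont eps 0); auto; now apply Ck_pd.
    + apply filter_forall; intros s; now apply (Ck_ex_RInt_q eps 1).
Qed.

Lemma is_derive_torus_int eps h t : Ck eps 1 h -> Rabs t < eps ->
  is_derive (fun t => torus_int (h t)) t (torus_int (pd3 0 h t)).
Proof.
  intros H Ht. pose proof PI_RGT_0.
  assert (E : torus_int (pd3 0 h t) = RInt (fun p => Derive (fun s => RInt (fun q => h s p q) 0 (2 * PI)) t) 0 (2 * PI)).
  { apply RInt_ext; intros p _; symmetry; apply is_derive_unique.
    exact (is_derive_RInt_q 0 eps h t p ltac:(lia) H Ht). }
  rewrite E.
  apply (is_derive_RInt_param (fun s p => RInt (fun q => h s p q) 0 (2 * PI))).
  - refine (filter_imp _ _ _ (slab_locally _ _ Ht)); intros s Hs p _.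
    eexists; exact (is_derive_RInt_q 0 eps h s p ltac:(lia) H Hs).
  - intros p _.
    apply (continuity_2d_pt_ext_loc (fun t p => RInt (fun q => pd3 0 h t p q) 0 (2 * PI))).
    + apply (locally_2d_slab _ eps); auto; intros s y Hs; symmetry; apply is_derive_unique.
      exact (is_derive_RInt_q 0 eps h s y ltac:(lia) H Hs).
    + apply (continuity_2d_RInt eps 0); auto; [lra|now apply Ck_pd].
  - refine (filter_imp _ _ _ (slab_locally _ _ Ht)); intros s Hs.
    now apply (Ck_ex_RInt_pq eps 1).
Qed.

Lemma torus_int_ext h k : (forall p q, h p q = k p q) -> torus_int h = torus_int k.
Proof. intros E; apply RInt_ext; intros p _; apply RInt_ext; intros q _; apply E. Qed.

Section TorusLinear.
Variable eps : R.
Hypothesis eps_pos : 0 < eps.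

Let Z : Rabs 0 < eps.
Proof. now rewrite Rabs_R0. Qed.

Lemma torus_int_plus h k : Ck eps 0 (lift2 h) -> Ck eps 0 (lift2 k) ->
  torus_int (fun p q => h p q + k p q) = torus_int h + torus_int k.
Proof.
  intros H K; unfold torus_int.
  rewrite <- (RInt_plus (V := R_CompleteNormedModule))
    by (exact (Ck_ex_RInt_pq _ _ _ 0 H Z) || exact (Ck_ex_RInt_pq _ _ _ 0 K Z)).
  apply RInt_ext; intros p _.
  apply (RInt_plus (V := R_CompleteNormedModule));
    [exact (Ck_ex_RInt_q _ _ _ 0 p _ _ H Z)|exact (Ck_ex_RInt_q _ _ _ 0 p _ _ K Z)].
Qed.

Lemma torus_int_scal h c : Ck eps 0 (lift2 h) ->
  torus_int (fun p q => c * h p q) = c * torus_int h.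
Proof.
  intros H; unfold torus_int.
  rewrite <- (RInt_scal (V := R_CompleteNormedModule)) by exact (Ck_ex_RInt_pq _ _ _ 0 H Z).
  apply RInt_ext; intros p _.
  apply (RInt_scal (V := R_CompleteNormedModule)). exact (Ck_ex_RInt_q _ _ _ 0 p _ _ H Z).
Qed.

(** Here p is the outer variable. Differentiating the inner integral under the sign and applying the
    fundamental theorem to p |-> int h dq avoids exchanging the order of integration. *)
Lemma torus_int_dp h : Ck eps 1 (lift2 h) -> periodic2 h -> torus_int (pd2 0 h) = 0.
Proof.
  intros H P. pose proof PI_RGT_0. unfold torus_int.
  transitivity (minus (RInt (fun q => h (2 * PI) q) 0 (2 * PI)) (RInt (fun q => h 0 q) 0 (2 * PI))).
  - apply (is_RInt_unique (V := R_CompleteNormedModule)).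
    apply (is_RInt_derive (V := R_CompleteNormedModule) (fun p => RInt (fun q => h p q) 0 (2 * PI))).
    + intros p _; exact (is_derive_RInt_q 1 eps (lift2 h) 0 p ltac:(lia) H Z).
    + intros p _. apply (cont2d_snd (fun t p => RInt (fun q => pd3 1 (lift2 h) t p q) 0 (2 * PI)) 0).
      apply (continuity_2d_RInt eps 0); auto; [lra|now apply Ck_pd].
  - replace (RInt (fun q => h (2 * PI) q) 0 (2 * PI)) with (RInt (fun q => h 0 q) 0 (2 * PI)).
    + apply (minus_eq_zero (G := R_AbelianGroup)).
    + apply RInt_ext; intros q _. rewrite <- (proj1 (P 0 q)). f_equal; ring.
Qed.

Lemma torus_int_dq h : Ck eps 1 (lift2 h) -> periodic2 h -> torus_int (pd2 1 h) = 0.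
Proof.
  intros H P. unfold torus_int. rewrite (RInt_ext _ (fun _ => 0)).
  - rewrite (RInt_const (V := R_CompleteNormedModule)). apply (scal_zero_r (V := R_NormedModule)).
  - intros p _. transitivity (minus (h p (2 * PI)) (h p 0)).
    + apply (is_RInt_unique (V := R_CompleteNormedModule)).
      apply (is_RInt_derive (V := R_CompleteNormedModule) (fun q => h p q)).
      * intros q _; exact (Ck_is _ _ _ 2 0 p q H Z).
      * intros q _; exact (Ck_continuous_q eps 0 (pd3 2 (lift2 h)) 0 p q (Ck_pd _ _ _ 2 H) Z).
    + replace (h p (2 * PI)) with (h p 0).
      * apply (minus_eq_zero (G := R_AbelianGroup)).
      * rewrite <- (proj2 (P p 0)). f_equal; ring.
Qed.
End TorusLinear.

(** * Positivity near t = 0 by compactness of the torus *)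

Lemma periodic2_Z (h : R -> R -> R) (m n : Z) p q : periodic2 h ->
  h (p + IZR m * (2 * PI)) (q + IZR n * (2 * PI)) = h p q.
Proof.
  intros P.
  assert (Q : forall u : R -> R, (forall x, u (x + 2 * PI) = u x) ->
            forall k x, u (x + IZR k * (2 * PI)) = u x).
  { intros u U k; induction k as [|k IH|k IH] using Z.peano_ind; intros x.
    - f_equal; ring.
    - rewrite <- (IH x), <- (U (x + IZR k * _)), succ_IZR. f_equal; ring.
    - rewrite <- (IH x), <- Z.sub_1_r, minus_IZR, <- (U (x + (IZR k - 1) * _)). f_equal; ring. }
  rewrite (Q (fun x => h x (q + IZR n * (2 * PI)))) by (intros; apply P).
  apply (Q (fun y => h p y)); intros; apply P.
Qed.

Lemma mod_2PI x : exists k, 0 <= x + IZR k * (2 * PI) <= 2 * PI.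
Proof.
  pose proof PI_RGT_0. exists (- Int_part (x / (2 * PI)))%Z.
  destruct (base_Int_part (x / (2 * PI))) as [A B].
  rewrite opp_IZR.
  set (m := IZR (Int_part (x / (2 * PI)))) in *.
  assert (E : x = x / (2 * PI) * (2 * PI)) by (field; lra).
  rewrite E at 1 2. nra.
Qed.

(** A cover of the closed square [0, 2 pi]^2 gives one time bound d, and translation by periods
    carries any (p, q) into that square. It is applied to the integrand u, to remove the absolute
    value in |u|^(3/2). *)
Lemma positive_near_0 eps h : 0 < eps -> Ck eps 0 h ->
  (forall t, Rabs t < eps -> periodic2 (h t)) -> (forall p q, 0 < h 0 p q) ->
  exists d, 0 < d <= eps /\ forall t p q, Rabs t < d -> 0 < h t p q.
Proof.
  intros He H P H0.
  assert (Z0 : Rabs 0 < eps) by (rewrite Rabs_R0; auto).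
  assert (C : forall p q, {d : posreal | forall t' p' q', Rabs t' < d ->
    Rabs (p' - p) < d -> Rabs (q' - q) < d -> 0 < h t' p' q'}).
  { intros p q; apply constructive_indefinite_description.
    destruct (Ck_cont _ _ _ 0 p q H Z0 _ (H0 p q)) as [d [Hd H1]].
    exists (mkposreal d Hd); simpl; intros t' p' q' A B D.
    assert (X : Rabs (h t' p' q' - h 0 p q) < h 0 p q) by (apply H1; auto; now rewrite Rminus_0_r).
    apply Rabs_def2 in X; lra. }
  destruct (compactness_value_2d 0 (2 * PI) 0 (2 * PI) (fun p q => proj1_sig (C p q))) as [d Hd].
  exists (Rmin d eps); split; [split; [apply Rmin_pos; auto; apply cond_pos|apply Rmin_r]|].
  intros t p q Ht.
  pose proof (Rmin_l d eps); pose proof (Rmin_r d eps).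
  destruct (mod_2PI p) as [m Hm], (mod_2PI q) as [n Hn].
  rewrite <- (periodic2_Z (h t) m n p q) by (apply P; lra).
  apply Rnot_le_lt; intros Hc. apply (Hd _ _ Hm Hn).
  intros [x [y [_ [_ [A [B D]]]]]].
  destruct (C x y) as [c Hc2]; simpl in *.
  apply (Rlt_not_le _ _ (Hc2 t _ _ ltac:(lra) A B)); auto.
Qed.

(** * Vector algebra and vector-valued functions *)

Lemma vdot_sym a b : vdot a b = vdot b a.
Proof. unfold vdot; ring. Qed.

Lemma vdot_addl a b c : vdot (vadd a b) c = vdot a c + vdot b c.
Proof. unfold vdot; simpl; ring. Qed.

Lemma vdot_addr a b c : vdot c (vadd a b) = vdot c a + vdot c b.
Proof. unfold vdot; simpl; ring. Qed.

Lemma vdot_scall x a b : vdot (vscal x a) b = x * vdot a b.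
Proof. unfold vdot; simpl; ring. Qed.

Lemma vdot_scalr x a b : vdot b (vscal x a) = x * vdot b a.
Proof. unfold vdot; simpl; ring. Qed.

Lemma vdot_J a b : vdot (Jv a) (Jv b) = vdot a b.
Proof. unfold vdot; simpl; ring. Qed.

Lemma vdot_Jl a b : vdot (Jv a) b = - vdot a (Jv b).
Proof. unfold vdot; simpl; ring. Qed.

Lemma vdot_Jself a : vdot a (Jv a) = 0.
Proof. unfold vdot; simpl; ring. Qed.

Lemma Jv_add a b : Jv (vadd a b) = vadd (Jv a) (Jv b).
Proof. unfold Jv, vadd; simpl; f_equal; ring. Qed.

Lemma Jv_scal x a : Jv (vscal x a) = vscal x (Jv a).
Proof. unfold Jv, vscal; simpl; f_equal; ring. Qed.

Lemma Jv_J a : Jv (Jv a) = vscal (-1) a.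
Proof. destruct a; unfold Jv, vscal; simpl; f_equal; ring. Qed.

Lemma Theta_vdot z v : Theta z v = vdot (Jv z) v.
Proof. unfold Theta, vdot; simpl; ring. Qed.

(* In C^2, [e] = l (- conj z2, conj z1) with l = r + i s of modulus 1. *)
Lemma unitary_frame z e v : vdot z z = 1 -> vdot e e = 1 -> vdot z e = 0 -> vdot (Jv z) e = 0 ->
  v = vadd (vadd (vscal (vdot v z) z) (vscal (vdot v (Jv z)) (Jv z)))
           (vadd (vscal (vdot v e) e) (vscal (vdot v (Jv e)) (Jv e))).
Proof.
  destruct z as [a b c d], e as [x y u w], v as [k l m n]; unfold vdot, Jv; simpl.
  intros Hz He H1 H2.
  (* l = r + i s is the determinant z_1 e_2 - z_2 e_1 of the complex matrix with columns z and e.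
     Each coordinate of e is recovered by multiplying it by |z|^2 = 1 and removing multiples of the
     orthogonality relations. *)
  set (r := a * u - b * w - c * x + d * y). set (s := a * w + b * u - c * y - d * x).
  assert (X : x = - c * r - d * s) by (unfold r, s;
    transitivity (x * (a * a + b * b + c * c + d * d) - a * (a * x + b * y + c * u + d * w)
      + b * (- b * x + a * y + - d * u + c * w)); [rewrite Hz, H1, H2; ring|ring]).
  assert (Y : y = d * r - c * s) by (unfold r, s;
    transitivity (y * (a * a + b * b + c * c + d * d) - b * (a * x + b * y + c * u + d * w)
      - a * (- b * x + a * y + - d * u + c * w)); [rewrite Hz, H1, H2; ring|ring]).
  assert (U : u = a * r + b * s) by (unfold r, s;
    transitivity (u * (a * a + b * b + c * c + d * d) - c * (a * x + b * y + c * u + d * w)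
      + d * (- b * x + a * y + - d * u + c * w)); [rewrite Hz, H1, H2; ring|ring]).
  assert (V : w = a * s - b * r) by (unfold r, s;
    transitivity (w * (a * a + b * b + c * c + d * d) - d * (a * x + b * y + c * u + d * w)
      - c * (- b * x + a * y + - d * u + c * w)); [rewrite Hz, H1, H2; ring|ring]).
  clearbody r s; subst x y u w. clear H1 H2.
  assert (S : r * r + s * s = 1).
  { rewrite <- He. transitivity ((r * r + s * s) * (a * a + b * b + c * c + d * d)); [rewrite Hz; ring|ring]. }
  clear He.
  unfold vadd, vscal; simpl; f_equal; nsatz.
Qed.

Definition VCk (eps : R) (n : nat) (u : R -> R -> R -> V4) : Prop :=
  Ck eps n (fun t p q => v1 (u t p q)) /\ Ck eps n (fun t p q => v2 (u t p q)) /\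
  Ck eps n (fun t p q => v3 (u t p q)) /\ Ck eps n (fun t p q => v4 (u t p q)).

Definition vpd (i : nat) (u : R -> R -> R -> V4) (t p q : R) : V4 :=
  mkV (pd3 i (fun t p q => v1 (u t p q)) t p q) (pd3 i (fun t p q => v2 (u t p q)) t p q)
      (pd3 i (fun t p q => v3 (u t p q)) t p q) (pd3 i (fun t p q => v4 (u t p q)) t p q).

Definition dotf (u v : R -> R -> R -> V4) (t p q : R) : R := vdot (u t p q) (v t p q).
Definition Jf (u : R -> R -> R -> V4) (t p q : R) : V4 := Jv (u t p q).

Lemma VCk_vpd eps n i u : VCk eps (S n) u -> VCk eps n (vpd i u).
Proof. intros [A [B [C D]]]; repeat split; simpl; now apply Ck_pd. Qed.

Lemma VCk_J eps n u : VCk eps n u -> VCk eps n (Jf u).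
Proof. intros [A [B [C D]]]; repeat split; simpl; auto; now apply Ck_opp. Qed.

Lemma VCk_add eps n u v : VCk eps n u -> VCk eps n v -> VCk eps n (fun t p q => vadd (u t p q) (v t p q)).
Proof.
  intros [A [B [C D]]] [A' [B' [C' D']]]; repeat split; simpl; now apply Ck_plus.
Qed.

Lemma VCk_scal eps n h u : Ck eps n h -> VCk eps n u -> VCk eps n (fun t p q => vscal (h t p q) (u t p q)).
Proof. intros H [A [B [C D]]]; repeat split; simpl; now apply Ck_mult. Qed.

Lemma Ck_dot eps n u v : VCk eps n u -> VCk eps n v -> Ck eps n (dotf u v).
Proof.
  intros [A [B [C D]]] [A' [B' [C' D']]]; unfold dotf, vdot.
  repeat apply Ck_plus; now apply Ck_mult.
Qed.

Lemma vpd_ext eps u v i t p q : (forall t p q, Rabs t < eps -> u t p q = v t p q) -> Rabs t < eps ->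
  vpd i u t p q = vpd i v t p q.
Proof.
  intros E Ht; unfold vpd; f_equal; apply (pd3_ext eps); auto; intros; now rewrite E.
Qed.

Lemma vpd_J u i t p q : vpd i (Jf u) t p q = Jv (vpd i u t p q).
Proof.
  unfold vpd, Jv; simpl; f_equal; rewrite !pd3_slice; destruct i as [|[|i]]; simpl;
    now rewrite Derive_opp.
Qed.

Lemma vpd_add eps u v i t p q : VCk eps 1 u -> VCk eps 1 v -> Rabs t < eps ->
  vpd i (fun t p q => vadd (u t p q) (v t p q)) t p q = vadd (vpd i u t p q) (vpd i v t p q).
Proof.
  intros [A [B [C D]]] [A' [B' [C' D']]] Ht; unfold vpd, vadd; simpl; f_equal;
    now apply (pd3_plus eps).
Qed.

Lemma vpd_scal eps h u i t p q : Ck eps 1 h -> VCk eps 1 u -> Rabs t < eps ->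
  vpd i (fun t p q => vscal (h t p q) (u t p q)) t p q =
  vadd (vscal (pd3 i h t p q) (u t p q)) (vscal (h t p q) (vpd i u t p q)).
Proof.
  intros H [A [B [C D]]] Ht; unfold vpd, vadd, vscal; simpl; f_equal;
    now apply (pd3_mult eps).
Qed.

Lemma vpd_comm_t eps u i t p q : VCk eps 2 u -> Rabs t < eps ->
  vpd 0 (vpd i u) t p q = vpd i (vpd 0 u) t p q.
Proof.
  intros [A [B [C D]]] Ht; unfold vpd at 1 3; f_equal; simpl; now apply (pd3_comm_t eps).
Qed.

Lemma pd3_dot eps u v i t p q : VCk eps 1 u -> VCk eps 1 v -> Rabs t < eps ->
  pd3 i (dotf u v) t p q = vdot (vpd i u t p q) (v t p q) + vdot (u t p q) (vpd i v t p q).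
Proof.
  intros [A [B [C D]]] [A' [B' [C' D']]] Ht; unfold dotf, vdot.
  rewrite !(pd3_plus eps) by (auto; repeat apply Ck_plus; now apply Ck_mult).
  rewrite !(pd3_mult eps) by auto. unfold vpd; simpl; ring.
Qed.

(** * Pointwise geometry of a nonsingular surface in the sphere *)

Lemma vdot_self_pos a : a <> mkV 0 0 0 0 -> 0 < vdot a a.
Proof.
  destruct a as [x y u w]; intros H; unfold vdot; simpl.
  destruct (Req_dec x 0), (Req_dec y 0), (Req_dec u 0), (Req_dec w 0); subst; try nra.
  now contradiction H.
Qed.

Lemma vnorm_sq a : vnorm a * vnorm a = vdot a a.
Proof. apply sqrt_sqrt; unfold vdot; nra. Qed.

(** [wvec] is the combination of S_p and S_q with coefficients - Theta(S_q) and Theta(S_p);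
    independence forces both to vanish if it is zero, which would make the point singular. *)
Lemma wvec_norm_pos S p q :
  (forall a b, vadd (vscal a (Sp S p q)) (vscal b (Sq S p q)) = mkV 0 0 0 0 -> a = 0 /\ b = 0) ->
  ~ (Theta (S p q) (Sp S p q) = 0 /\ Theta (S p q) (Sq S p q) = 0) ->
  0 < vnorm (wvec S p q).
Proof.
  intros Him Hns; apply sqrt_lt_R0, vdot_self_pos; intros H; apply Hns.
  destruct (Him (- Theta (S p q) (Sq S p q)) (Theta (S p q) (Sp S p q))) as [A B]; [|lra].
  rewrite <- H; unfold wvec, vsub, vadd, vscal; simpl; f_equal; ring.
Qed.

Lemma frame_ext z e u v : vdot z z = 1 -> vdot e e = 1 -> vdot z e = 0 -> vdot (Jv z) e = 0 ->
  vdot u z = vdot v z -> vdot u (Jv z) = vdot v (Jv z) -> vdot u e = vdot v e ->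
  vdot u (Jv e) = vdot v (Jv e) -> u = v.
Proof.
  intros Hz He H1 H2 A B C D.
  rewrite (unitary_frame z e u Hz He H1 H2), (unitary_frame z e v Hz He H1 H2).
  now rewrite A, B, C, D.
Qed.

Section Pointwise.
Variables (S : R -> R -> V4) (p q : R).
Notation z := (S p q).
Notation X := (Sp S p q).
Notation Y := (Sq S p q).
Notation N := (vnorm (wvec S p q)).
Notation E := (e1 S p q).
Hypothesis zz : vdot z z = 1.
Hypothesis zX : vdot z X = 0.
Hypothesis zY : vdot z Y = 0.
Hypothesis Npos : 0 < N.

Lemma wvec_e1 : wvec S p q = vscal N E.
Proof.
  unfold e1; destruct (wvec S p q); unfold vscal; simpl; f_equal; field; lra.
Qed.

Lemma e1_unit : vdot E E = 1.
Proof.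
  unfold e1; rewrite vdot_scall, vdot_scalr, <- vnorm_sq; field; lra.
Qed.

Lemma e1_orth_z : vdot z E = 0.
Proof.
  unfold e1, wvec, vsub; rewrite !vdot_scalr, !vdot_addr, !vdot_scalr, zX, zY; ring.
Qed.

Lemma e1_horizontal : vdot (Jv z) E = 0.
Proof.
  unfold e1, wvec, vsub; rewrite !vdot_scalr, !vdot_addr, !vdot_scalr, !Theta_vdot; apply Rmult_eq_0_compat_l; ring.
Qed.

(** Pair w = N e1 with e1. Pairing it with e2 instead gives the tangency relation [tangent_e2]. *)
Lemma wvec_norm_det : N = Theta z X * vdot Y E - Theta z Y * vdot X E.
Proof.
  transitivity (vdot (vscal N E) E); [rewrite vdot_scall, e1_unit; ring|].
  rewrite <- wvec_e1; unfold wvec, vsub; rewrite !vdot_addl, !vdot_scall; ring.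
Qed.

Lemma ThetaE1_norm : ThetaE1 S p q = N.
Proof. symmetry; apply wvec_norm_det. Qed.

Lemma tangent_e2 : Theta z X * vdot Y (Jv E) - Theta z Y * vdot X (Jv E) = 0.
Proof.
  transitivity (vdot (vscal N E) (Jv E)); [|rewrite vdot_scall, vdot_Jself; ring].
  rewrite <- wvec_e1; unfold wvec, vsub; rewrite !vdot_addl, !vdot_scall; ring.
Qed.

(** [epsilon] says nothing until existence is known, so uniqueness and existence are both proved.
    The T and e1 components of the defining identity determine c and d, with determinant N, and the
    e2 component then gives alpha. *)
Lemma alpha_formula :
  alpha S p q = (vdot Y E * vdot X (Jv E) - vdot X E * vdot Y (Jv E)) / N.
Proof.
  pose proof wvec_norm_det as HN. pose proof e1_unit as Hu. pose proof e1_orth_z as Hz.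
  pose proof e1_horizontal as Hh. pose proof tangent_e2 as Ht. rewrite !Theta_vdot in HN.
  assert (U : forall a, (exists c d, vadd (Reeb z) (vscal a (e2 S p q)) = vadd (vscal c X) (vscal d Y)) ->
    a = (vdot Y E * vdot X (Jv E) - vdot X E * vdot Y (Jv E)) / N).
  { intros a [c [d H]]. unfold Reeb, e2 in H.
    pose proof (f_equal (fun v => vdot v E) H) as H1.
    pose proof (f_equal (fun v => vdot v (Jv E)) H) as H2.
    pose proof (f_equal (fun v => vdot (Jv z) v) H) as H3.
    simpl in H1, H2, H3.
    rewrite !vdot_addl, !vdot_scall in H1, H2. rewrite !vdot_addr, !vdot_scalr in H3.
    rewrite vdot_J in H2, H3. rewrite vdot_J in H3. rewrite (vdot_sym (Jv E) E), vdot_Jself, Hh in H1.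
    rewrite vdot_J, Hz, Hu in H2. rewrite zz, Hz in H3.
    apply (Rmult_eq_reg_r N); [|lra]. unfold Rdiv; rewrite Rmult_assoc, Rinv_l by lra.
    revert HN H1 H2 H3; generalize N (vdot (Jv z) X) (vdot (Jv z) Y) (vdot X E) (vdot Y E)
      (vdot X (Jv E)) (vdot Y (Jv E)); clear; intros; nsatz. }
  apply U. unfold alpha; apply epsilon_spec.
  (* c and d solve c Theta(X) + d Theta(Y) = 1 and c <X, e1> + d <Y, e1> = 0 by Cramer's rule; the
     equality of vectors is then checked on the four frame components. *)
  exists ((vdot Y E * vdot X (Jv E) - vdot X E * vdot Y (Jv E)) / N), (vdot Y E / N), (- vdot X E / N).
  rewrite !Theta_vdot in Ht.
  unfold Reeb, e2.
  apply (frame_ext z E _ _ zz Hu Hz Hh); rewrite ?vdot_addl, ?vdot_scall, ?vdot_J, ?vdot_Jself.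
  all: rewrite ?(vdot_sym X z), ?(vdot_sym Y z), ?zX, ?zY, ?(vdot_sym X (Jv z)), ?(vdot_sym Y (Jv z)).
  all: rewrite ?(vdot_sym (Jv z) z), ?(vdot_sym (Jv E) z), ?(vdot_sym (Jv E) E), ?vdot_Jself, ?Hh, ?zz, ?Hu.
  all: rewrite ?vdot_J, ?(vdot_sym E z), ?Hz.
  all: apply (Rmult_eq_reg_r N); [|lra].
  - assert (Hj : vdot z (Jv E) = 0) by (rewrite vdot_Jl in Hh; lra).
    rewrite Hj; ring.
  - transitivity (vdot (Jv z) X * vdot Y E - vdot (Jv z) Y * vdot X E); [rewrite <- HN; ring|field; lra].
  - field; lra.
  - field; lra.
Qed.

End Pointwise.

(** * Periodicity *)

(** The difference quotients already agree before the limit, so periodicity passes formally through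
    all the geometric quantities. *)
Lemma Derive_shift h k c x : (forall r, h (r + c) = k r) -> Derive h (x + c) = Derive k x.
Proof.
  intros Hs; unfold Derive; f_equal; apply Lim_ext; intros y.
  rewrite <- !Hs; do 3 f_equal; ring.
Qed.

Lemma dvec_shift h k c x : (forall r, h (r + c) = k r) -> dvec h (x + c) = dvec k x.
Proof. intros Hs; unfold dvec; f_equal; apply Derive_shift; intros; now rewrite Hs. Qed.

Lemma dvec_ext h k x : (forall r, h r = k r) -> dvec h x = dvec k x.
Proof. intros Hs; unfold dvec; f_equal; apply Derive_ext; intros; now rewrite Hs. Qed.

Lemma periodic_Derive_p (h : R -> R -> R) : periodic2 h -> periodic2 (fun p q => Derive (fun r => h r q) p).
Proof.
  intros Hp p q; split; [apply Derive_shift|apply Derive_ext]; intros r; apply Hp.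
Qed.

Lemma periodic_Derive_q (h : R -> R -> R) : periodic2 h -> periodic2 (fun p q => Derive (fun r => h p r) q).
Proof.
  intros Hp p q; split; [apply Derive_ext|apply Derive_shift]; intros r; apply Hp.
Qed.

Lemma periodic_dvec_p (h : R -> R -> V4) : periodic2 h -> periodic2 (fun p q => dvec (fun r => h r q) p).
Proof.
  intros Hp p q; split; [apply dvec_shift|apply dvec_ext]; intros r; apply Hp.
Qed.

Lemma periodic_dvec_q (h : R -> R -> V4) : periodic2 h -> periodic2 (fun p q => dvec (fun r => h p r) q).
Proof.
  intros Hp p q; split; [apply dvec_ext|apply dvec_shift]; intros r; apply Hp.
Qed.

Section Periodic.
Variable S : R -> R -> V4.
Hypothesis S_per : periodic2 S.

Lemma periodic_Sp : periodic2 (Sp S).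
Proof. exact (periodic_dvec_p S S_per). Qed.

Lemma periodic_Sq : periodic2 (Sq S).
Proof. exact (periodic_dvec_q S S_per). Qed.

Ltac periodic H1 H2 H3 := intros p q; destruct (H1 p q) as [A1 B1], (H2 p q) as [A2 B2], (H3 p q) as [A3 B3].

Lemma periodic_wvec : periodic2 (wvec S).
Proof.
  periodic S_per periodic_Sp periodic_Sq; unfold wvec; now rewrite A1, A2, A3, B1, B2, B3.
Qed.

Lemma periodic_e1 : periodic2 (e1 S).
Proof.
  intros p q; destruct (periodic_wvec p q) as [A B]; unfold e1; now rewrite A, B.
Qed.

Lemma periodic_ca : periodic2 (ca S).
Proof.
  periodic S_per periodic_wvec periodic_Sq; unfold ca; now rewrite A1, A2, A3, B1, B2, B3.
Qed.

Lemma periodic_cb : periodic2 (cb S).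
Proof.
  periodic S_per periodic_wvec periodic_Sp; unfold cb; now rewrite A1, A2, A3, B1, B2, B3.
Qed.

(** The predicates given to [epsilon] at the two points are the same after rewriting, so the same
    value is chosen. *)
Lemma periodic_alpha : periodic2 (alpha S).
Proof.
  periodic S_per periodic_Sp periodic_Sq; destruct (periodic_e1 p q) as [A4 B4].
  unfold alpha, e2; now rewrite A1, A2, A3, A4, B1, B2, B3, B4.
Qed.

Lemma periodic_pH : periodic2 (pH S).
Proof.
  periodic periodic_ca periodic_cb periodic_e1.
  destruct (periodic_dvec_p _ periodic_e1 p q) as [A4 B4], (periodic_dvec_q _ periodic_e1 p q) as [A5 B5].
  unfold pH, e1_vec, e2; now rewrite A1, A2, A3, A4, A5, B1, B2, B3, B4, B5.
Qed.

Lemma periodic_E1_integrand : periodic2 (E1_integrand S).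
Proof.
  periodic periodic_ca periodic_cb periodic_alpha; destruct (periodic_pH p q) as [A4 B4].
  destruct (periodic_Derive_p _ periodic_alpha p q) as [A5 B5], (periodic_Derive_q _ periodic_alpha p q) as [A6 B6].
  unfold E1_integrand, e1_fun; now rewrite A1, A2, A3, A4, A5, A6, B1, B2, B3, B4, B5, B6.
Qed.
End Periodic.

(** * Variations of the Clifford torus *)

Lemma Ck_e1C eps n h : Ck eps (S n) (lift2 h) -> Ck eps n (lift2 (e1C h)).
Proof.
  intros H; apply (Ck_plus eps n (fun t p q => - pd3 1 (lift2 h) t p q) (pd3 2 (lift2 h)));
    [apply Ck_opp|]; now apply Ck_pd.
Qed.

Lemma Ck_TC eps n h : Ck eps (S n) (lift2 h) -> Ck eps n (lift2 (TC h)).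
Proof.
  intros H; apply (Ck_plus eps n (pd3 1 (lift2 h)) (pd3 2 (lift2 h))); now apply Ck_pd.
Qed.

(** Derivatives along the surface see a single time slice. This allows identities known only at t =
    0 to be differentiated in p and q. *)
Lemma pd3_slice_ext h k i t p q : (0 < i)%nat -> (forall p q, h t p q = k t p q) ->
  pd3 i h t p q = pd3 i k t p q.
Proof.
  intros Hi E; destruct i as [|[|i]]; [lia| |]; apply Derive_ext; intros; apply E.
Qed.

Section Family.
Variables (eps : R) (F : R -> R -> R -> V4) (f g : R -> R -> R).
Hypothesis eps_pos : 0 < eps.
Hypothesis F_smooth : forall n, VCk eps n F.
Hypothesis F_sphere : forall t p q, Rabs t < eps -> vnorm (F t p q) = 1.
Hypothesis F_nonsing : forall t p q, Rabs t < eps -> 0 < vnorm (wvec (F t) p q).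
Hypothesis f_smooth : forall n, Ck eps n (lift2 f).
Hypothesis g_smooth : forall n, Ck eps n (lift2 g).
Hypothesis F_evol : forall t p q, Rabs t < eps ->
  vpd 0 F t p q = vadd (vscal (f p q) (e2 (F t) p q)) (vscal (g p q) (Reeb (F t p q))).

(* [P], [Q] and [Rp], [Rq] are the components of S_p, S_q along e1 and e2;
   [Tp], [Tq] are those along T. *)
Let X := vpd 1 F.
Let Y := vpd 2 F.
Let Tp (t p q : R) := Theta (F t p q) (X t p q).
Let Tq (t p q : R) := Theta (F t p q) (Y t p q).
Let N (t p q : R) := vnorm (wvec (F t) p q).
Let E (t p q : R) := e1 (F t) p q.
Let P := dotf X E.
Let Q := dotf Y E.
Let a (t p q : R) := ca (F t) p q.
Let b (t p q : R) := cb (F t) p q.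
Let al (t p q : R) := alpha (F t) p q.
Let H (t p q : R) := pH (F t) p q.
Let U (t p q : R) := E1_integrand (F t) p q.

Lemma family_X n : VCk eps n X. Proof. apply VCk_vpd, F_smooth. Qed.
Lemma family_Y n : VCk eps n Y. Proof. apply VCk_vpd, F_smooth. Qed.

Lemma family_Tp n : Ck eps n Tp.
Proof.
  apply (Ck_ext eps n (dotf (Jf F) X)); [intros; symmetry; apply Theta_vdot|].
  apply Ck_dot; [apply VCk_J, F_smooth|apply family_X].
Qed.

Lemma family_Tq n : Ck eps n Tq.
Proof.
  apply (Ck_ext eps n (dotf (Jf F) Y)); [intros; symmetry; apply Theta_vdot|].
  apply Ck_dot; [apply VCk_J, F_smooth|apply family_Y].
Qed.

Lemma family_w n : VCk eps n (fun t p q => wvec (F t) p q).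
Proof.
  apply (VCk_add eps n (fun t p q => vscal (Tp t p q) (Y t p q))
    (fun t p q => vscal (-1) (vscal (Tq t p q) (X t p q)))).
  - apply VCk_scal; [apply family_Tp|apply family_Y].
  - apply (VCk_scal eps n (fun _ _ _ => -1)); [apply Ck_const|].
    apply VCk_scal; [apply family_Tq|apply family_X].
Qed.

Lemma family_N n : Ck eps n N.
Proof.
  apply (Ck_sqrt eps n (dotf (fun t p q => wvec (F t) p q) (fun t p q => wvec (F t) p q))).
  - intros t p q Ht; unfold dotf; rewrite <- vnorm_sq; pose proof (F_nonsing t p q Ht); nra.
  - apply Ck_dot; apply family_w.
Qed.

Lemma N_ne t p q : Rabs t < eps -> N t p q <> 0.
Proof. intros Ht; pose proof (F_nonsing t p q Ht); unfold N; lra. Qed.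

Lemma family_E n : VCk eps n E.
Proof.
  apply (VCk_scal eps n (fun t p q => / N t p q)); [|apply family_w].
  apply Ck_inv; [apply N_ne|apply family_N].
Qed.

Lemma family_JE n : VCk eps n (Jf E). Proof. apply VCk_J, family_E. Qed.
Lemma family_JF n : VCk eps n (Jf F). Proof. apply VCk_J, F_smooth. Qed.
Lemma family_P n : Ck eps n P. Proof. apply Ck_dot; [apply family_X|apply family_E]. Qed.
Lemma family_Q n : Ck eps n Q. Proof. apply Ck_dot; [apply family_Y|apply family_E]. Qed.

Lemma family_a n : Ck eps n a.
Proof. apply (Ck_div eps n (fun t p q => - Tq t p q) N N_ne); [apply Ck_opp, family_Tq|apply family_N]. Qed.

Lemma family_b n : Ck eps n b.
Proof. apply (Ck_div eps n Tp N N_ne); [apply family_Tp|apply family_N]. Qed.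

Lemma FF t p q : Rabs t < eps -> vdot (F t p q) (F t p q) = 1.
Proof. intros Ht; rewrite <- vnorm_sq, F_sphere by auto; ring. Qed.

Lemma unit_orth (u : R -> R -> R -> V4) c i t p q : VCk eps 1 u ->
  (forall t p q, Rabs t < eps -> vdot (u t p q) (u t p q) = c) -> Rabs t < eps ->
  vdot (u t p q) (vpd i u t p q) = 0.
Proof.
  intros Hu Hc Ht.
  pose proof (pd3_dot eps u u i t p q Hu Hu Ht) as D.
  rewrite (pd3_ext eps _ (fun _ _ _ => c)) in D by auto.
  rewrite pd3_slice in D.
  replace (Derive _ _) with 0 in D by (destruct i as [|[|i]]; simpl; now rewrite Derive_const).
  rewrite (vdot_sym (vpd i u t p q)) in D. lra.
Qed.

Lemma FX t p q : Rabs t < eps -> vdot (F t p q) (X t p q) = 0.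
Proof. intros Ht; apply (unit_orth F 1); auto using FF. Qed.

Lemma FY t p q : Rabs t < eps -> vdot (F t p q) (Y t p q) = 0.
Proof. intros Ht; apply (unit_orth F 1); auto using FF. Qed.

Lemma EE t p q : Rabs t < eps -> vdot (E t p q) (E t p q) = 1.
Proof. intros Ht; apply (e1_unit (F t) p q); now apply F_nonsing. Qed.

Lemma FE t p q : Rabs t < eps -> vdot (F t p q) (E t p q) = 0.
Proof. intros Ht; apply (e1_orth_z (F t) p q); [now apply FX|now apply FY]. Qed.

Lemma JFE t p q : vdot (Jv (F t p q)) (E t p q) = 0.
Proof. exact (e1_horizontal (F t) p q). Qed.

Lemma FJE t p q : vdot (F t p q) (Jv (E t p q)) = 0.
Proof. pose proof (JFE t p q) as D; rewrite vdot_Jl in D; lra. Qed.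

Lemma N_det t p q : Rabs t < eps -> N t p q = Tp t p q * Q t p q - Tq t p q * P t p q.
Proof. intros Ht; apply (wvec_norm_det (F t) p q); now apply F_nonsing. Qed.

Lemma N_E t p q : Rabs t < eps ->
  vadd (vscal (Tp t p q) (Y t p q)) (vscal (-1) (vscal (Tq t p q) (X t p q))) = vscal (N t p q) (E t p q).
Proof. intros Ht; apply (wvec_e1 (F t) p q); now apply F_nonsing. Qed.

Let Rp := dotf X (Jf E).
Let Rq := dotf Y (Jf E).

Lemma family_Rp n : Ck eps n Rp. Proof. apply Ck_dot; [apply family_X|apply family_JE]. Qed.
Lemma family_Rq n : Ck eps n Rq. Proof. apply Ck_dot; [apply family_Y|apply family_JE]. Qed.

Lemma tangency t p q : Rabs t < eps -> Tp t p q * Rq t p q - Tq t p q * Rp t p q = 0.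
Proof. intros Ht; apply (tangent_e2 (F t) p q); now apply F_nonsing. Qed.

Lemma al_formula t p q : Rabs t < eps ->
  al t p q = (Q t p q * Rp t p q - P t p q * Rq t p q) / N t p q.
Proof.
  intros Ht; apply (alpha_formula (F t) p q); [now apply FF|now apply FX|now apply FY|now apply F_nonsing].
Qed.

Lemma family_al n : Ck eps n al.
Proof.
  apply (Ck_ext eps n (fun t p q => (Q t p q * Rp t p q - P t p q * Rq t p q) / N t p q)).
  - intros; symmetry; now apply al_formula.
  - apply (Ck_div eps n (fun t p q => Q t p q * Rp t p q - P t p q * Rq t p q)); [apply N_ne| |apply family_N].
    apply Ck_minus; apply Ck_mult; auto using family_P, family_Q, family_Rp, family_Rq.
Qed.

Lemma H_formula t p q : H t p q =
  a t p q * vdot (vpd 1 E t p q) (Jv (E t p q)) + b t p q * vdot (vpd 2 E t p q) (Jv (E t p q)).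
Proof.
  unfold H, pH, e1_vec, e2. rewrite vdot_addl, !vdot_scall. reflexivity.
Qed.

Lemma family_H n : Ck eps n H.
Proof.
  apply (Ck_ext eps n (fun t p q => a t p q * dotf (vpd 1 E) (Jf E) t p q + b t p q * dotf (vpd 2 E) (Jf E) t p q)).
  - intros; now rewrite H_formula.
  - apply Ck_plus; apply Ck_mult; auto using family_a, family_b;
      apply Ck_dot; auto using family_JE, VCk_vpd, family_E.
Qed.

Lemma U_formula t p q : U t p q =
  a t p q * pd3 1 al t p q + b t p q * pd3 2 al t p q + al t p q * al t p q * / 2 +
  H t p q * H t p q * / 6 + / 2.
Proof.
  unfold U, E1_integrand, e1_fun. fold (a t p q) (b t p q).
  change (alpha (F t)) with (al t). fold (H t p q).
  change (Derive (fun r => al t r q) p) with (pd3 1 al t p q).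
  change (Derive (fun r => al t p r) q) with (pd3 2 al t p q). field.
Qed.

Lemma family_U n : Ck eps n U.
Proof.
  apply (Ck_ext eps n (fun t p q => a t p q * pd3 1 al t p q + b t p q * pd3 2 al t p q
    + al t p q * al t p q * / 2 + H t p q * H t p q * / 6 + / 2)).
  - intros; now rewrite U_formula.
  - repeat apply Ck_plus; try apply Ck_const.
    1, 2: apply Ck_mult; auto using family_a, family_b; apply Ck_pd, family_al.
    1, 2: apply Ck_mult; [apply Ck_mult; auto using family_al, family_H|apply Ck_const].
Qed.

Lemma ThetaE1_N t p q : Rabs t < eps -> ThetaE1 (F t) p q = N t p q.
Proof. intros Ht; apply (ThetaE1_norm (F t) p q); now apply F_nonsing. Qed.

(** * Evolution equations *)

Lemma F_t t p q : Rabs t < eps ->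
  vpd 0 F t p q = vadd (vscal (f p q) (Jv (E t p q))) (vscal (g p q) (Jv (F t p q))).
Proof. exact (F_evol t p q). Qed.

Lemma F_ti i t p q : Rabs t < eps ->
  vpd 0 (vpd i F) t p q =
  vadd (vadd (vscal (pd3 i (lift2 f) t p q) (Jv (E t p q))) (vscal (f p q) (Jv (vpd i E t p q))))
       (vadd (vscal (pd3 i (lift2 g) t p q) (Jv (F t p q))) (vscal (g p q) (Jv (vpd i F t p q)))).
Proof.
  intros Ht. rewrite (vpd_comm_t eps) by auto.
  rewrite (vpd_ext eps _ (fun t p q => vadd (vscal (lift2 f t p q) (Jf E t p q)) (vscal (lift2 g t p q) (Jf F t p q))))
    by (auto; exact F_t).
  rewrite (vpd_add eps) by (auto; apply VCk_scal; auto using family_JE, family_JF).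
  rewrite !(vpd_scal eps), !vpd_J by (auto; auto using family_JE, family_JF).
  reflexivity.
Qed.

Lemma E_E i t p q : Rabs t < eps -> vdot (E t p q) (vpd i E t p q) = 0.
Proof. intros Ht; apply (unit_orth E 1); auto using EE, family_E. Qed.

Lemma E_t_F t p q : Rabs t < eps -> vdot (F t p q) (vpd 0 E t p q) = 0.
Proof.
  intros Ht.
  pose proof (pd3_dot eps F E 0 t p q (F_smooth 1) (family_E 1) Ht) as D.
  rewrite (pd3_ext eps _ (fun _ _ _ => 0)) in D by (auto; exact FE).
  rewrite F_t, vdot_addl, !vdot_scall, JFE, (vdot_sym (Jv (E t p q))), vdot_Jself in D by auto.
  replace (pd3 0 (fun _ _ _ => 0) t p q) with 0 in D by (symmetry; exact (Derive_const 0 t)).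
  lra.
Qed.

Lemma E_t_JF t p q : Rabs t < eps -> vdot (vpd 0 E t p q) (Jv (F t p q)) = f p q.
Proof.
  intros Ht.
  pose proof (pd3_dot eps (Jf F) E 0 t p q (family_JF 1) (family_E 1) Ht) as D.
  rewrite (pd3_ext eps _ (fun _ _ _ => 0)) in D by (auto; intros; apply JFE).
  rewrite vpd_J, F_t, Jv_add, !Jv_scal, !Jv_J, vdot_addl, !vdot_scall, FE, EE in D by auto.
  replace (pd3 0 (fun _ _ _ => 0) t p q) with 0 in D by (symmetry; exact (Derive_const 0 t)).
  unfold Jf in D. rewrite vdot_sym; lra.
Qed.

(** This is Cartan's formula for the Lie derivative of Theta along f e2 + g T: the field has
    Theta-value g, and dTheta = 2 e^1 /\ e^2 on xi gives dTheta(f e2, X) = -2 f e^1(X). *)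
Lemma Theta_t i t p q : Rabs t < eps ->
  pd3 0 (dotf (Jf F) (vpd i F)) t p q = pd3 i (lift2 g) t p q - 2 * f p q * vdot (vpd i F t p q) (E t p q).
Proof.
  intros Ht.
  rewrite (pd3_dot eps) by (auto using family_JF, VCk_vpd).
  rewrite vpd_J, F_t, F_ti by auto. unfold Jf.
  rewrite Jv_add, !Jv_scal, !Jv_J, !vdot_addl, !vdot_addr, !vdot_scall, !vdot_scalr, !vdot_J, FE, FF by auto.
  assert (A : vdot (F t p q) (vpd i F t p q) = 0) by (apply (unit_orth F 1); auto using FF).
  assert (B : vdot (F t p q) (vpd i E t p q) = - vdot (vpd i F t p q) (E t p q)).
  { pose proof (pd3_dot eps F E i t p q (F_smooth 1) (family_E 1) Ht) as D.
    rewrite (pd3_ext eps _ (fun _ _ _ => 0)) in D by (auto; exact FE).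
    rewrite pd3_slice in D.
    replace (Derive _ _) with 0 in D by (destruct i as [|[|i']]; simpl; now rewrite Derive_const).
    lra. }
  rewrite A, B, (vdot_sym (E t p q)). ring.
Qed.

Lemma Tp_t t p q : Rabs t < eps -> pd3 0 Tp t p q = pd3 1 (lift2 g) t p q - 2 * f p q * P t p q.
Proof.
  intros Ht; rewrite (pd3_ext eps Tp (dotf (Jf F) X)) by (auto; intros; apply Theta_vdot).
  now apply Theta_t.
Qed.

Lemma Tq_t t p q : Rabs t < eps -> pd3 0 Tq t p q = pd3 2 (lift2 g) t p q - 2 * f p q * Q t p q.
Proof.
  intros Ht; rewrite (pd3_ext eps Tq (dotf (Jf F) Y)) by (auto; intros; apply Theta_vdot).
  now apply Theta_t.
Qed.

Lemma F_ti_E i t p q : Rabs t < eps -> vdot (vpd 0 (vpd i F) t p q) (E t p q) =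
  - f p q * vdot (vpd i E t p q) (Jv (E t p q)) + g p q * vdot (Jv (vpd i F t p q)) (E t p q).
Proof.
  intros Ht; rewrite F_ti, !vdot_addl, !vdot_scall, JFE, (vdot_Jl (vpd i E t p q)) by auto.
  rewrite (vdot_sym (Jv (E t p q))), vdot_Jself. ring.
Qed.

(** Differentiate N = Tp Q - Tq P. The terms -2 f P Q and 2 f Q P cancel. As Tp Y - Tq X = N E, the
    terms with E_t add up to N <E, E_t> = 0 ([D1]) and those with g to a multiple of <JE, E> = 0
    ([D2]). What stays is the mean curvature term and the derivative of g along (Q S_p - P S_q)/N,
    times N. *)
Lemma N_t t p q : Rabs t < eps -> pd3 0 N t p q =
  - (N t p q * f p q * H t p q) + (pd3 1 (lift2 g) t p q * Q t p q - pd3 2 (lift2 g) t p q * P t p q).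
Proof.
  intros Ht.
  rewrite (pd3_ext eps N (fun t p q => Tp t p q * Q t p q + (-1) * (Tq t p q * P t p q)))
    by (auto; intros; rewrite N_det by auto; ring).
  assert (C1 : Ck eps 1 (fun t p q => Tq t p q * P t p q)) by (apply Ck_mult; auto using family_Tq, family_P).
  rewrite (pd3_plus eps), (pd3_mult eps (fun _ _ _ => -1)), !(pd3_mult eps)
    by auto using Ck_mult, Ck_const, family_Tp, family_Tq, family_P, family_Q.
  rewrite Tp_t, Tq_t by auto.
  replace (pd3 0 (fun _ _ _ => -1) t p q) with 0 by (symmetry; exact (Derive_const (-1) t)).
  change (pd3 0 P t p q) with (pd3 0 (dotf X E) t p q). change (pd3 0 Q t p q) with (pd3 0 (dotf Y E) t p q).
  pose proof (F_ti_E 1 t p q Ht) as G1; pose proof (F_ti_E 2 t p q Ht) as G2.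
  fold X in G1; fold Y in G2.
  rewrite !(pd3_dot eps), G1, G2 by auto using family_X, family_Y, family_E.
  pose proof (f_equal (fun v => vdot v (vpd 0 E t p q)) (N_E t p q Ht)) as D1.
  pose proof (f_equal (fun v => vdot (Jv v) (E t p q)) (N_E t p q Ht)) as D2.
  simpl in D1, D2.
  rewrite vdot_addl, !vdot_scall, E_E in D1 by auto.
  rewrite Jv_add, !Jv_scal, vdot_addl, !vdot_scall, (vdot_sym (Jv (E t p q))), vdot_Jself in D2.
  rewrite H_formula. unfold a, b, ca, cb. fold X Y.
  change (Sp (F t) p q) with (X t p q). change (Sq (F t) p q) with (Y t p q).
  fold (Tp t p q) (Tq t p q) (N t p q).
  pose proof (N_ne t p q Ht) as Nn.
  replace (- (N t p q * f p q * (- Tq t p q / N t p q * vdot (vpd 1 E t p q) (Jv (E t p q)) +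
    Tp t p q / N t p q * vdot (vpd 2 E t p q) (Jv (E t p q))))) with
    (- f p q * (- Tq t p q * vdot (vpd 1 E t p q) (Jv (E t p q)) +
    Tp t p q * vdot (vpd 2 E t p q) (Jv (E t p q)))) by (field; auto).
  change (vpd 1 F t p q) with (X t p q). change (vpd 2 F t p q) with (Y t p q).
  nsatz.
Qed.

(** * First variation of the frame at the torus *)

Lemma sqrt2_half : / sqrt 2 * / sqrt 2 = / 2.
Proof. rewrite <- Rinv_mult, sqrt_sqrt by lra; reflexivity. Qed.

Lemma sin_cos_sq x : sin x * sin x + cos x * cos x = 1.
Proof. pose proof (sin2_cos2 x) as S; unfold Rsqr in S; exact S. Qed.

Lemma Sp_cliff p q : Sp cliff p q = mkV (- sin p / sqrt 2) (cos p / sqrt 2) 0 0.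
Proof.
  unfold Sp, dvec, cliff; simpl; f_equal; apply is_derive_unique; auto_derive; auto; unfold Rdiv; ring.
Qed.

Lemma Sq_cliff p q : Sq cliff p q = mkV 0 0 (- sin q / sqrt 2) (cos q / sqrt 2).
Proof.
  unfold Sq, dvec, cliff; simpl; f_equal; apply is_derive_unique; auto_derive; auto; unfold Rdiv; ring.
Qed.

Lemma wvec_cliff p q : wvec cliff p q =
  vscal (/ 2) (mkV (sin p / sqrt 2) (- cos p / sqrt 2) (- sin q / sqrt 2) (cos q / sqrt 2)).
Proof.
  pose proof sqrt2_half as S. pose proof (sin_cos_sq p) as Ep; pose proof (sin_cos_sq q) as Eq.
  unfold wvec, vsub; rewrite Sp_cliff, Sq_cliff.
  assert (A : Theta (cliff p q) (mkV (- sin p / sqrt 2) (cos p / sqrt 2) 0 0) = / 2).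
  { rewrite <- S, <- (Rmult_1_r (_ * _)), <- Ep; unfold Theta, cliff, Rdiv; simpl; ring. }
  assert (B : Theta (cliff p q) (mkV 0 0 (- sin q / sqrt 2) (cos q / sqrt 2)) = / 2).
  { rewrite <- S, <- (Rmult_1_r (_ * _)), <- Eq; unfold Theta, cliff, Rdiv; simpl; ring. }
  rewrite A, B; unfold vadd, vscal, Rdiv; simpl; f_equal; ring.
Qed.

Lemma wvec_cliff_norm p q : vnorm (wvec cliff p q) = / 2.
Proof.
  rewrite wvec_cliff; unfold vnorm; rewrite vdot_scall, vdot_scalr.
  rewrite <- (sqrt_square (/ 2)) at 3 by lra. f_equal.
  rewrite <- (Rmult_1_r (/ 2 * / 2)), <- Rmult_assoc. f_equal.
  pose proof sqrt2_half as S. pose proof (sin_cos_sq p) as Ep; pose proof (sin_cos_sq q) as Eq.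
  unfold vdot, Rdiv; simpl.
  transitivity ((/ sqrt 2 * / sqrt 2) * ((sin p * sin p + cos p * cos p) + (sin q * sin q + cos q * cos q)));
    [ring|rewrite S, Ep, Eq; field].
Qed.

(** In complex notation e1 = (-i z_1, i z_2) on the torus, which is the field - d/dphi_1 + d/dphi_2
    of the statement. *)
Lemma e1_cliff p q : e1 cliff p q =
  mkV (sin p / sqrt 2) (- cos p / sqrt 2) (- sin q / sqrt 2) (cos q / sqrt 2).
Proof.
  unfold e1; rewrite wvec_cliff_norm, wvec_cliff; unfold vscal; simpl; f_equal; field;
    pose proof Rlt_sqrt2_0; lra.
Qed.

Hypothesis F_0 : F 0 = cliff.

Lemma zero_slab : Rabs 0 < eps.
Proof. rewrite Rabs_R0; exact eps_pos. Qed.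
Hint Resolve zero_slab : core.

Section AtZero.
Variables p q : R.

Lemma N_0 : N 0 p q = / 2.
Proof. unfold N; rewrite F_0; apply wvec_cliff_norm. Qed.

(** Inversion of e1 = - d/dphi_1 + d/dphi_2 and T = d/dphi_1 + d/dphi_2. *)
Lemma X_0 : X 0 p q = vscal (/ 2) (vadd (Jv (F 0 p q)) (vscal (-1) (E 0 p q))).
Proof.
  change (X 0 p q) with (Sp (F 0) p q). unfold E; rewrite F_0, Sp_cliff, e1_cliff.
  unfold cliff, vadd, vscal, Rdiv; simpl; f_equal; field; pose proof Rlt_sqrt2_0; lra.
Qed.

Lemma Y_0 : Y 0 p q = vscal (/ 2) (vadd (Jv (F 0 p q)) (E 0 p q)).
Proof.
  change (Y 0 p q) with (Sq (F 0) p q). unfold E; rewrite F_0, Sq_cliff, e1_cliff.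
  unfold cliff, vadd, vscal, Rdiv; simpl; f_equal; field; pose proof Rlt_sqrt2_0; lra.
Qed.

Lemma E_p_0 : vpd 1 E 0 p q = vscal (/ 2) (vadd (F 0 p q) (Jv (E 0 p q))).
Proof.
  change (vpd 1 E 0 p q) with (dvec (fun r => e1 (F 0) r q) p). unfold E; rewrite F_0.
  replace (fun r => e1 cliff r q) with
    (fun r => mkV (sin r / sqrt 2) (- cos r / sqrt 2) (- sin q / sqrt 2) (cos q / sqrt 2))
    by (apply functional_extensionality; intros; now rewrite e1_cliff).
  rewrite e1_cliff. pose proof Rlt_sqrt2_0.
  unfold dvec, cliff, vadd, vscal; simpl; f_equal; apply is_derive_unique; auto_derive; auto; field; lra.
Qed.

Lemma E_q_0 : vpd 2 E 0 p q = vscal (/ 2) (vadd (vscal (-1) (F 0 p q)) (Jv (E 0 p q))).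
Proof.
  change (vpd 2 E 0 p q) with (dvec (fun r => e1 (F 0) p r) q). unfold E; rewrite F_0.
  replace (fun r => e1 cliff p r) with
    (fun r => mkV (sin p / sqrt 2) (- cos p / sqrt 2) (- sin r / sqrt 2) (cos r / sqrt 2))
    by (apply functional_extensionality; intros; now rewrite e1_cliff).
  rewrite e1_cliff. pose proof Rlt_sqrt2_0.
  unfold dvec, cliff, vadd, vscal; simpl; f_equal; apply is_derive_unique; auto_derive; auto; field; lra.
Qed.

(** Expands tangent vectors and derivatives of e1 at t = 0 in the orthonormal frame z, Jz, e1, Je1
    and evaluates the inner products. *)
Ltac frame0 :=
  unfold Tp, Tq, P, Q, Rp, Rq, dotf, Jf;
  rewrite ?Theta_vdot, ?X_0, ?Y_0, ?E_p_0, ?E_q_0, ?Jv_scal, ?Jv_add, ?Jv_scal, ?Jv_J;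
  rewrite ?vdot_scall, ?vdot_scalr, ?vdot_addl, ?vdot_addr, ?vdot_scall, ?vdot_scalr, ?vdot_J;
  rewrite ?JFE, ?FJE, ?FE, ?FF, ?EE, ?vdot_Jself, ?(vdot_sym (Jv (E 0 p q)) (E 0 p q)),
    ?(vdot_sym (Jv (E 0 p q)) (F 0 p q)), ?(vdot_sym (Jv (F 0 p q)) (F 0 p q)),
    ?(vdot_sym (E 0 p q) (F 0 p q)), ?(vdot_sym (E 0 p q) (Jv (F 0 p q))),
    ?JFE, ?FJE, ?FE, ?FF, ?EE, ?vdot_Jself by auto.

Lemma Tp_0 : Tp 0 p q = / 2. Proof. frame0; field. Qed.
Lemma Tq_0 : Tq 0 p q = / 2. Proof. frame0; field. Qed.
Lemma P_0 : P 0 p q = - / 2. Proof. frame0; field. Qed.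
Lemma Q_0 : Q 0 p q = / 2. Proof. frame0; field. Qed.
Lemma Rp_0 : Rp 0 p q = 0. Proof. frame0; field. Qed.
Lemma Rq_0 : Rq 0 p q = 0. Proof. frame0; field. Qed.

Lemma a_0 : a 0 p q = -1.
Proof.
  change (a 0 p q) with (- Tq 0 p q / N 0 p q). rewrite Tq_0, N_0; field.
Qed.

Lemma b_0 : b 0 p q = 1.
Proof.
  change (b 0 p q) with (Tp 0 p q / N 0 p q). rewrite Tp_0, N_0; field.
Qed.

Lemma al_0 : al 0 p q = 0.
Proof. rewrite al_formula, Rp_0, Rq_0 by auto; unfold Rdiv; ring. Qed.

Lemma H_0 : H 0 p q = 0.
Proof. rewrite H_formula, a_0, b_0; frame0; field. Qed.

Lemma N_t_0 : pd3 0 N 0 p q = / 2 * TC g p q.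
Proof.
  rewrite N_t, N_0, H_0, P_0, Q_0 by auto.
  change (TC g p q) with (pd3 1 (lift2 g) 0 p q + pd3 2 (lift2 g) 0 p q). field.
Qed.

(** Cleared of denominators, so that a_t and b_t follow from the product rule. *)
Lemma a_N t : Rabs t < eps -> a t p q * N t p q = - Tq t p q.
Proof.
  intros Ht; change (a t p q) with (- Tq t p q / N t p q); field; now apply N_ne.
Qed.

Lemma b_N t : Rabs t < eps -> b t p q * N t p q = Tp t p q.
Proof.
  intros Ht; change (b t p q) with (Tp t p q / N t p q); field; now apply N_ne.
Qed.
End AtZero.

Lemma a_t_0 p q : pd3 0 a 0 p q = 2 * f p q - e1C g p q.
Proof.
  pose proof (pd3_mult eps a N 0 0 p q (family_a 1) (family_N 1) zero_slab) as D.
  rewrite (pd3_ext eps _ (fun t p q => -1 * Tq t p q)) in D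
    by (auto; intros; rewrite a_N by auto; ring).
  rewrite (pd3_mult eps (fun _ _ _ => -1)), Tq_t, N_t_0, N_0, a_0, Q_0 in D by auto using Ck_const, family_Tq.
  change (pd3 0 (fun _ _ _ => -1) 0 p q) with (Derive (fun _ => -1) 0) in D. rewrite Derive_const in D.
  change (TC g p q) with (pd3 1 (lift2 g) 0 p q + pd3 2 (lift2 g) 0 p q) in D.
  change (e1C g p q) with (- pd3 1 (lift2 g) 0 p q + pd3 2 (lift2 g) 0 p q).
  lra.
Qed.

Lemma b_t_0 p q : pd3 0 b 0 p q = 2 * f p q - e1C g p q.
Proof.
  pose proof (pd3_mult eps b N 0 0 p q (family_b 1) (family_N 1) zero_slab) as D.
  rewrite (pd3_ext eps _ Tp) in D by (auto; intros; now apply b_N).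
  rewrite Tp_t, N_t_0, N_0, b_0, P_0 in D by auto.
  change (TC g p q) with (pd3 1 (lift2 g) 0 p q + pd3 2 (lift2 g) 0 p q) in D.
  change (e1C g p q) with (- pd3 1 (lift2 g) 0 p q + pd3 2 (lift2 g) 0 p q).
  lra.
Qed.

Ltac dot_norm :=
  rewrite ?vdot_scall, ?vdot_scalr, ?vdot_addl, ?vdot_addr, ?vdot_scall, ?vdot_scalr.

(** The motion along e2 contributes - f <E_p, JE> = - f/2, and the turning of e1 towards T
    contributes <X, E_t> = f/2. With its analogue for Q this removes the g-terms from N_tt. *)
Lemma P_t_0 p q : pd3 0 P 0 p q = 0.
Proof.
  unfold P; rewrite (pd3_dot eps) by auto using family_X, family_E.
  change (vpd 0 X 0 p q) with (vpd 0 (vpd 1 F) 0 p q).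
  rewrite F_ti_E by auto. change (vpd 1 F 0 p q) with (X 0 p q).
  rewrite X_0, E_p_0, Jv_scal, Jv_add, Jv_scal, Jv_J; dot_norm.
  rewrite (vdot_sym (Jv (F 0 p q)) (vpd 0 E 0 p q)), E_t_JF, E_E, FJE, FE, vdot_J, EE,
    (vdot_sym (Jv (E 0 p q))), vdot_Jself by auto. field.
Qed.

Lemma Q_t_0 p q : pd3 0 Q 0 p q = 0.
Proof.
  unfold Q; rewrite (pd3_dot eps) by auto using family_Y, family_E.
  change (vpd 0 Y 0 p q) with (vpd 0 (vpd 2 F) 0 p q).
  rewrite F_ti_E by auto. change (vpd 2 F 0 p q) with (Y 0 p q).
  rewrite Y_0, E_q_0, Jv_scal, Jv_add, Jv_J; dot_norm.
  rewrite (vdot_sym (Jv (F 0 p q)) (vpd 0 E 0 p q)), E_t_JF, E_E, FJE, FE, vdot_J, EE,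
    (vdot_sym (Jv (E 0 p q))), vdot_Jself by auto. field.
Qed.

Let w (p q : R) := g p q + e1C f p q.

Lemma F_ti_JE i t p q : Rabs t < eps -> vdot (vpd 0 (vpd i F) t p q) (Jv (E t p q)) =
  pd3 i (lift2 f) t p q + g p q * vdot (vpd i F t p q) (E t p q).
Proof.
  intros Ht; rewrite F_ti by auto; dot_norm.
  rewrite !vdot_J, EE, FE, (vdot_sym (vpd i E t p q)), E_E by auto. ring.
Qed.

Lemma Rp_t_0 p q : pd3 0 Rp 0 p q =
  pd3 1 (lift2 f) 0 p q - g p q / 2 + vdot (vpd 0 E 0 p q) (Jv (E 0 p q)) / 2.
Proof.
  unfold Rp; rewrite (pd3_dot eps), vpd_J by auto using family_X, family_JE.
  change (vpd 0 X 0 p q) with (vpd 0 (vpd 1 F) 0 p q). unfold Jf at 1.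
  rewrite F_ti_JE by auto. change (vdot (vpd 1 F 0 p q) (E 0 p q)) with (P 0 p q).
  rewrite P_0, X_0; dot_norm.
  rewrite vdot_J, E_t_F, (vdot_sym (vpd 0 E 0 p q)), vdot_Jl by auto. field.
Qed.

Lemma Rq_t_0 p q : pd3 0 Rq 0 p q =
  pd3 2 (lift2 f) 0 p q + g p q / 2 - vdot (vpd 0 E 0 p q) (Jv (E 0 p q)) / 2.
Proof.
  unfold Rq; rewrite (pd3_dot eps), vpd_J by auto using family_Y, family_JE.
  change (vpd 0 Y 0 p q) with (vpd 0 (vpd 2 F) 0 p q). unfold Jf at 1.
  rewrite F_ti_JE by auto. change (vdot (vpd 2 F 0 p q) (E 0 p q)) with (Q 0 p q).
  rewrite Q_0, Y_0; dot_norm.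
  rewrite vdot_J, E_t_F, (vdot_sym (vpd 0 E 0 p q)), vdot_Jl by auto. field.
Qed.

(** E stays tangent to the moving surface, so Tp Rq - Tq Rp = 0 may be differentiated in t. Since Rp
    and Rq vanish on the torus, only Rp_t and Rq_t survive, and they contain the unknown component
    linearly. *)
Lemma E_t_JE_0 p q : vdot (vpd 0 E 0 p q) (Jv (E 0 p q)) = w p q.
Proof.
  assert (D : pd3 0 (fun t p q => Tp t p q * Rq t p q + -1 * (Tq t p q * Rp t p q)) 0 p q = 0).
  { rewrite (pd3_ext eps _ (fun _ _ _ => 0)); auto; [exact (Derive_const 0 0)|].
    intros t x y Ht; pose proof (tangency t x y Ht); lra. }
  rewrite (pd3_plus eps), (pd3_mult eps (fun _ _ _ => -1)), !(pd3_mult eps) in D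
    by auto using Ck_mult, Ck_const, family_Tp, family_Tq, family_Rp, family_Rq.
  rewrite Rp_0, Rq_0, Tp_0, Tq_0, Rp_t_0, Rq_t_0 in D.
  unfold w; change (e1C f p q) with (- pd3 1 (lift2 f) 0 p q + pd3 2 (lift2 f) 0 p q).
  lra.
Qed.

(** In the derivative of alpha N = Q Rp - P Rq, the terms P_t and Q_t multiply zero, and in Rp_t +
    Rq_t both g and the rotation of e1 cancel. *)
Lemma al_t_0 p q : pd3 0 al 0 p q = TC f p q.
Proof.
  pose proof (pd3_mult eps al N 0 0 p q (family_al 1) (family_N 1) zero_slab) as D.
  rewrite (pd3_ext eps _ (fun t p q => Q t p q * Rp t p q + -1 * (P t p q * Rq t p q))) in D
    by (auto; intros t x y Ht; rewrite al_formula by auto; field; now apply N_ne).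
  rewrite (pd3_plus eps), (pd3_mult eps (fun _ _ _ => -1)), !(pd3_mult eps) in D
    by auto using Ck_mult, Ck_const, family_P, family_Q, family_Rp, family_Rq.
  change (pd3 0 (fun _ _ _ => -1) 0 p q) with (Derive (fun _ => -1) 0) in D. rewrite Derive_const in D.
  rewrite Rp_0, Rq_0, P_0, Q_0, Rp_t_0, Rq_t_0, E_t_JE_0, al_0, N_0 in D.
  change (TC f p q) with (pd3 1 (lift2 f) 0 p q + pd3 2 (lift2 f) 0 p q). lra.
Qed.

(** [E_t_JE_0] holds on the whole torus, so it can be differentiated along it. *)
Lemma E_ti_JE_0 i p q : (0 < i)%nat -> vdot (vpd 0 (vpd i E) 0 p q) (Jv (E 0 p q)) =
  pd3 i (lift2 w) 0 p q - vdot (vpd 0 E 0 p q) (Jv (vpd i E 0 p q)).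
Proof.
  intros Hi.
  pose proof (pd3_dot eps (vpd 0 E) (Jf E) i 0 p q (VCk_vpd _ _ _ _ (family_E 2)) (family_JE 1) zero_slab) as D.
  rewrite (pd3_slice_ext _ (lift2 w)), vpd_J in D by (auto; exact E_t_JE_0).
  rewrite (vpd_comm_t eps) by auto using family_E. unfold Jf in D. lra.
Qed.

(** Of 4 f, one half comes from a_t = b_t = 2 f - e1 g and the other from <E_t, Jz> = f paired with
    the z-components of E_p and E_q. The term - e1 g is cancelled by e1 applied to w = g + e1 f. *)
Lemma H_t_0 p q : pd3 0 H 0 p q = e1C (e1C f) p q + 4 * f p q.
Proof.
  rewrite (pd3_ext eps _ (fun t p q => a t p q * dotf (vpd 1 E) (Jf E) t p q + b t p q * dotf (vpd 2 E) (Jf E) t p q))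
    by (auto; intros; apply H_formula).
  assert (D1 : forall i, Ck eps 1 (dotf (vpd i E) (Jf E)))
    by (intros; apply Ck_dot; auto using family_JE, VCk_vpd, family_E).
  rewrite (pd3_plus eps), !(pd3_mult eps), !(pd3_dot eps) by
    auto using Ck_mult, family_a, family_b, VCk_vpd, family_E, family_JE.
  rewrite !vpd_J, a_0, b_0, a_t_0, b_t_0. unfold dotf, Jf.
  rewrite !E_ti_JE_0 by lia.
  rewrite E_p_0, E_q_0, !Jv_scal, !Jv_add, !Jv_scal, !Jv_J; dot_norm.
  assert (FJE_t : vdot (F 0 p q) (Jv (vpd 0 E 0 p q)) = - f p q)
    by (rewrite <- (E_t_JF 0 p q), (vdot_sym (vpd 0 E 0 p q)), vdot_Jl by auto; ring).
  rewrite !vdot_J, FJE_t, E_t_JF, FJE, EE, (vdot_sym (vpd 0 E 0 p q) (E 0 p q)), E_E by auto.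
  change (pd3 1 (lift2 w) 0 p q) with (pd3 1 (fun t p q => lift2 g t p q + lift2 (e1C f) t p q) 0 p q).
  change (pd3 2 (lift2 w) 0 p q) with (pd3 2 (fun t p q => lift2 g t p q + lift2 (e1C f) t p q) 0 p q).
  rewrite !(pd3_plus eps) by auto using Ck_e1C.
  change (e1C g p q) with (- pd3 1 (lift2 g) 0 p q + pd3 2 (lift2 g) 0 p q).
  change (e1C (e1C f) p q) with (- pd3 1 (lift2 (e1C f)) 0 p q + pd3 2 (lift2 (e1C f)) 0 p q).
  field.
Qed.

(** * Second t-derivatives of the integrand and of the area density at the torus *)

Lemma al_i_0 i p q : (0 < i)%nat -> pd3 i al 0 p q = 0.
Proof.
  intros Hi; rewrite (pd3_slice_ext _ (fun _ _ _ => 0)) by (auto; exact al_0).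
  destruct i as [|[|i]]; [lia| |]; apply (Derive_const 0).
Qed.

Lemma al_it_0 i p q : (0 < i)%nat -> pd3 0 (pd3 i al) 0 p q = pd3 i (lift2 (TC f)) 0 p q.
Proof.
  intros Hi; rewrite (pd3_comm_t eps) by auto using family_al.
  apply pd3_slice_ext; [auto|exact al_t_0].
Qed.

Lemma al_itt i t p q : Rabs t < eps -> pd3 0 (pd3 0 (pd3 i al)) t p q = pd3 i (pd3 0 (pd3 0 al)) t p q.
Proof.
  intros Ht.
  rewrite (pd3_ext eps _ (pd3 i (pd3 0 al))) by (auto; intros; apply (pd3_comm_t eps); auto using family_al).
  apply (pd3_comm_t eps); auto. apply Ck_pd, family_al.
Qed.

Lemma U_0 p q : U 0 p q = / 2.
Proof. rewrite U_formula, !al_i_0, al_0, H_0 by lia; ring. Qed.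

Lemma U_split t p q : U t p q = (a t p q * pd3 1 al t p q + b t p q * pd3 2 al t p q) +
  (/ 2 * (al t p q * al t p q) + (/ 6 * (H t p q * H t p q) + / 2)).
Proof. rewrite U_formula; ring. Qed.

Ltac Ck_auto :=
  repeat first [apply family_a | apply family_b | apply family_al | apply family_H
    | apply Ck_const | apply Ck_pd | apply Ck_plus | apply Ck_mult].

Lemma U_t_0 p q : pd3 0 U 0 p q = e1C (TC f) p q.
Proof.
  rewrite (pd3_ext eps _ _ _ _ _ _ (fun t p q _ => U_split t p q)) by auto.
  rewrite !(pd3_plus eps) by (auto; Ck_auto).
  rewrite (pd3_mult eps a), (pd3_mult eps b), (pd3_mult eps (fun _ _ _ => / 2)),
    (pd3_mult eps (fun _ _ _ => / 6)), (pd3_mult eps al), (pd3_mult eps H) by (auto; Ck_auto).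
  rewrite !pd3_const, !al_i_0, !al_it_0, al_0, H_0, a_0, b_0 by lia.
  change (e1C (TC f) p q) with (- pd3 1 (lift2 (TC f)) 0 p q + pd3 2 (lift2 (TC f)) 0 p q). ring.
Qed.

Let alpha_tt (p q : R) := pd3 0 (pd3 0 al) 0 p q.

(** a_tt and b_tt multiply derivatives of alpha along the torus, which vanish there; the mixed terms
    2 a_t alpha_pt + 2 b_t alpha_qt give the term with TTf. *)
Lemma U_tt_0 p q : pd3 0 (pd3 0 U) 0 p q = e1C alpha_tt p q
  + 2 * (2 * f p q - e1C g p q) * TC (TC f) p q + TC f p q ^ 2 + (e1C (e1C f) p q + 4 * f p q) ^ 2 / 3.
Proof.
  rewrite (pd3_ext eps _ (pd3 0 (fun t p q => (a t p q * pd3 1 al t p q + b t p q * pd3 2 al t p q) +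
    (/ 2 * (al t p q * al t p q) + (/ 6 * (H t p q * H t p q) + / 2)))))
    by (auto; intros; apply (pd3_ext eps); auto; intros; apply U_split).
  rewrite !(pd3_plus_tt eps) by (auto; Ck_auto).
  rewrite (pd3_mult_tt eps a), (pd3_mult_tt eps b), (pd3_mult_tt eps (fun _ _ _ => / 2)),
    (pd3_mult_tt eps (fun _ _ _ => / 6)), (pd3_mult_tt eps al), (pd3_mult_tt eps H) by (auto; Ck_auto).
  assert (Cz : forall c, pd3 0 (pd3 0 (fun _ _ _ => c)) 0 p q = 0).
  { intros c; rewrite (pd3_ext eps _ (fun _ _ _ => 0)) by (auto; intros; apply pd3_const).
    apply pd3_const. }
  rewrite !Cz, !pd3_const, !al_i_0, !al_it_0, !al_itt, al_0, H_0, a_0, b_0, a_t_0, b_t_0, al_t_0, H_t_0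
    by (auto; lia).
  change (e1C alpha_tt p q) with (- pd3 1 (pd3 0 (pd3 0 al)) 0 p q + pd3 2 (pd3 0 (pd3 0 al)) 0 p q).
  change (TC (TC f) p q) with (pd3 1 (lift2 (TC f)) 0 p q + pd3 2 (lift2 (TC f)) 0 p q). field.
Qed.

(** H = 0 on the torus leaves only H_t from the curvature term; g does not depend on t, and P_t =
    Q_t = 0. *)
Lemma N_tt_0 p q : pd3 0 (pd3 0 N) 0 p q = - / 2 * f p q * (e1C (e1C f) p q + 4 * f p q).
Proof.
  rewrite (pd3_ext eps _ (fun t p q => -1 * ((N t p q * lift2 f t p q) * H t p q) +
    (pd3 1 (lift2 g) t p q * Q t p q + -1 * (pd3 2 (lift2 g) t p q * P t p q))))
    by (auto; intros; rewrite N_t by auto; unfold lift2; ring).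
  rewrite !(pd3_plus eps), !(pd3_mult eps (fun _ _ _ => -1)), !(pd3_mult eps) by
    auto 10 using Ck_plus, Ck_mult, Ck_const, Ck_pd, family_N, family_H, family_P, family_Q.
  rewrite !pd3_const, P_t_0, Q_t_0, H_0, H_t_0, N_0.
  assert (G : forall i, pd3 0 (pd3 i (lift2 g)) 0 p q = 0).
  { intros i; rewrite (pd3_comm_t eps) by auto.
    rewrite (pd3_ext eps _ (fun _ _ _ => 0)) by (auto; intros; apply pd3_lift2_t).
    destruct i as [|[|i]]; apply (Derive_const 0). }
  rewrite !G. unfold lift2. ring.
Qed.

(** * Integrating by parts *)

Hypothesis F_per : forall t, Rabs t < eps -> periodic2 (F t).
Hypothesis f_per : periodic2 f.
Hypothesis g_per : periodic2 g.

Lemma torus_int_e1C h : Ck eps 1 (lift2 h) -> periodic2 h -> torus_int (e1C h) = 0.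
Proof.
  intros Hh Hp.
  transitivity (torus_int (fun p q => -1 * pd2 0 h p q + pd2 1 h p q)).
  { apply torus_int_ext; intros p q; unfold e1C, pd2; ring. }
  rewrite (torus_int_plus eps), (torus_int_scal eps), (torus_int_dp eps), (torus_int_dq eps); auto.
  - ring.
  - exact (Ck_pd _ _ _ 1 Hh).
  - apply (Ck_mult eps 0 (fun _ _ _ => -1) (pd3 1 (lift2 h))); [apply Ck_const|now apply Ck_pd].
  - exact (Ck_pd _ _ _ 2 Hh).
Qed.

Lemma torus_int_TC h : Ck eps 1 (lift2 h) -> periodic2 h -> torus_int (TC h) = 0.
Proof.
  intros Hh Hp.
  transitivity (torus_int (fun p q => pd2 0 h p q + pd2 1 h p q)); [reflexivity|].
  rewrite (torus_int_plus eps), (torus_int_dp eps), (torus_int_dq eps); auto.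
  - ring.
  - exact (Ck_pd _ _ _ 1 Hh).
  - exact (Ck_pd _ _ _ 2 Hh).
Qed.

Lemma periodic_e1C h : periodic2 h -> periodic2 (e1C h).
Proof.
  intros Hh p q; destruct (periodic_Derive_p _ Hh p q) as [A B], (periodic_Derive_q _ Hh p q) as [C D].
  unfold e1C; now rewrite A, B, C, D.
Qed.

Lemma periodic_TC h : periodic2 h -> periodic2 (TC h).
Proof.
  intros Hh p q; destruct (periodic_Derive_p _ Hh p q) as [A B], (periodic_Derive_q _ Hh p q) as [C D].
  unfold TC; now rewrite A, B, C, D.
Qed.

Lemma e1C_mult h k p q : Ck eps 1 (lift2 h) -> Ck eps 1 (lift2 k) ->
  e1C (fun p q => h p q * k p q) p q = e1C h p q * k p q + h p q * e1C k p q.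
Proof.
  intros Hh Hk.
  pose proof (pd3_mult eps _ _ 1 0 p q Hh Hk zero_slab) as D1.
  pose proof (pd3_mult eps _ _ 2 0 p q Hh Hk zero_slab) as D2.
  unfold pd3, lift2 in D1, D2; unfold e1C; rewrite D1, D2; ring.
Qed.

Lemma TC_mult h k p q : Ck eps 1 (lift2 h) -> Ck eps 1 (lift2 k) ->
  TC (fun p q => h p q * k p q) p q = TC h p q * k p q + h p q * TC k p q.
Proof.
  intros Hh Hk.
  pose proof (pd3_mult eps _ _ 1 0 p q Hh Hk zero_slab) as D1.
  pose proof (pd3_mult eps _ _ 2 0 p q Hh Hk zero_slab) as D2.
  unfold pd3, lift2 in D1, D2; unfold TC; rewrite D1, D2; ring.
Qed.

Lemma e1C_TC_comm h p q : Ck eps 2 (lift2 h) -> e1C (TC h) p q = TC (e1C h) p q.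
Proof.
  intros Hh.
  pose proof (fun i => Ck_pd _ _ _ i Hh) as H1.
  change (e1C (TC h) p q) with
    (- pd3 1 (fun t p q => pd3 1 (lift2 h) t p q + pd3 2 (lift2 h) t p q) 0 p q
     + pd3 2 (fun t p q => pd3 1 (lift2 h) t p q + pd3 2 (lift2 h) t p q) 0 p q).
  change (TC (e1C h) p q) with
    (pd3 1 (fun t p q => - pd3 1 (lift2 h) t p q + pd3 2 (lift2 h) t p q) 0 p q
     + pd3 2 (fun t p q => - pd3 1 (lift2 h) t p q + pd3 2 (lift2 h) t p q) 0 p q).
  assert (O : forall i, pd3 i (fun t p q => - pd3 1 (lift2 h) t p q + pd3 2 (lift2 h) t p q) 0 p q =
    - pd3 i (pd3 1 (lift2 h)) 0 p q + pd3 i (pd3 2 (lift2 h)) 0 p q).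
  { intros i. rewrite (pd3_plus eps) by auto using Ck_opp. f_equal.
    rewrite !pd3_slice; destruct i as [|[|i]]; apply Derive_opp. }
  rewrite !O, !(pd3_plus eps), (pd3_comm_pq eps) by auto. ring.
Qed.

(* The second t-derivative of u^(3/2) N at t = 0, divided by N = 1/2. *)
Let second_t (p q : R) : R := sqrt (/ 2) *
  (3 / 2 * (e1C alpha_tt p q + 2 * (2 * f p q - e1C g p q) * TC (TC f) p q + TC f p q ^ 2
      + (e1C (e1C f) p q + 4 * f p q) ^ 2 / 3) + 3 / 2 * e1C (TC f) p q ^ 2
   + 3 * e1C (TC f) p q * TC g p q
   - / 2 * f p q * (e1C (e1C f) p q + 4 * f p q)).

(* All terms containing [g] or [alpha_tt] are divergences. *)
Lemma second_t_divergence p q : second_t p q =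
  sqrt (/ 2) / 2 * second_var_integrand f p q + sqrt (/ 2) *
  (3 / 2 * e1C alpha_tt p q
   + 3 * e1C (fun p q => TC f p q * TC g p q) p q + 7 / 2 * e1C (fun p q => f p q * e1C f p q) p q
   - 3 * TC (fun p q => e1C g p q * TC f p q) p q + 3 / 2 * TC (fun p q => f p q * TC f p q) p q).
Proof.
  (* The product f e1 e1 f has coefficient 4 - 1/2 = 7/2 and becomes - 7/2 (e1 f)^2; 3/2 (Tf)^2
     becomes - 3/2 f TTf, which joins 6 f TTf to give 9/2. The terms 3 (e1 T f)(T g) - 3 (e1 g) TTf
     are a divergence because e1 and T commute on g. *)
  rewrite !e1C_mult, !TC_mult by auto using Ck_e1C, Ck_TC.
  rewrite (e1C_TC_comm g) by auto.
  unfold second_t, second_var_integrand. field.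
Qed.

Lemma Ck_lift2_mult n h k : Ck eps n (lift2 h) -> Ck eps n (lift2 k) ->
  Ck eps n (lift2 (fun p q => h p q * k p q)).
Proof. exact (Ck_mult eps n (lift2 h) (lift2 k)). Qed.

Lemma Ck_lift2_plus n h k : Ck eps n (lift2 h) -> Ck eps n (lift2 k) ->
  Ck eps n (lift2 (fun p q => h p q + k p q)).
Proof. exact (Ck_plus eps n (lift2 h) (lift2 k)). Qed.

Lemma Ck_lift2_scal n c h : Ck eps n (lift2 h) -> Ck eps n (lift2 (fun p q => c * h p q)).
Proof. exact (Ck_mult eps n (fun _ _ _ => c) (lift2 h) (Ck_const eps n c)). Qed.

Lemma Ck_second_var n : Ck eps n (lift2 (second_var_integrand f)).
Proof.
  apply (Ck_ext eps n (fun t p q => lift2 (e1C (e1C f)) t p q ^ 2 + 3 * lift2 (e1C (TC f)) t p q ^ 2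
    - 7 * lift2 (e1C f) t p q ^ 2 + 9 * lift2 f t p q * lift2 (TC (TC f)) t p q + 12 * lift2 f t p q ^ 2));
    [reflexivity|].
  repeat first [solve [auto using Ck_e1C, Ck_TC] | apply Ck_const | apply Ck_pow
    | apply Ck_plus | apply Ck_opp | apply Ck_mult].
Qed.

Lemma Ck_alpha_tt n : Ck eps n (lift2 alpha_tt).
Proof. apply (Ck_freeze eps n (pd3 0 (pd3 0 al)) 0); auto using Ck_pd, family_al. Qed.

Lemma Ck_second_t n : Ck eps n (lift2 second_t).
Proof.
  apply (Ck_ext eps n (fun t p q => sqrt (/ 2) *
    (3 / 2 * (lift2 (e1C alpha_tt) t p q + 2 * (2 * lift2 f t p q - lift2 (e1C g) t p q) * lift2 (TC (TC f)) t p q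
      + lift2 (TC f) t p q ^ 2 + (lift2 (e1C (e1C f)) t p q + 4 * lift2 f t p q) ^ 2 * / 3)
    + 3 / 2 * lift2 (e1C (TC f)) t p q ^ 2
    + 3 * lift2 (e1C (TC f)) t p q * lift2 (TC g) t p q
    - / 2 * lift2 f t p q * (lift2 (e1C (e1C f)) t p q + 4 * lift2 f t p q)))); [reflexivity|].
  repeat first [solve [auto using Ck_e1C, Ck_TC, Ck_alpha_tt] | apply Ck_const | apply Ck_pow
    | apply Ck_plus | apply Ck_opp | apply Ck_mult].
Qed.

(** A t-derivative inherits periodicity from nearby times, not from the single slice, so the claim
    is proved on the slab and applied twice. *)
Lemma periodic_alpha_tt : periodic2 alpha_tt.
Proof.
  assert (T : forall h, (forall t, Rabs t < eps -> periodic2 (h t)) ->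
    forall t, Rabs t < eps -> periodic2 (pd3 0 h t)).
  { intros h Hh t Ht p q; split; apply Derive_ext_loc;
      refine (filter_imp _ _ _ (slab_locally _ _ Ht)); intros s Hs; now apply Hh. }
  apply (T (pd3 0 al)); auto; apply T; intros; apply periodic_alpha; auto.
Qed.

Lemma periodic_mult h k : periodic2 h -> periodic2 k -> periodic2 (fun p q : R => h p q * k p q).
Proof. intros A B p q; destruct (A p q) as [A1 A2], (B p q) as [B1 B2]; now rewrite A1, A2, B1, B2. Qed.

Lemma torus_int_second : torus_int second_t =
  sqrt (/ 2) / 2 * torus_int (second_var_integrand f).
Proof.
  set (k := sqrt (/ 2)).
  pose (M2 := fun p q => TC f p q * TC g p q). pose (M3 := fun p q => f p q * e1C f p q).
  pose (M4 := fun p q => e1C g p q * TC f p q). pose (M5 := fun p q => f p q * TC f p q).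
  assert (C2 : forall n, Ck eps n (lift2 M2)) by (intros; apply Ck_lift2_mult; auto using Ck_TC).
  assert (C3 : forall n, Ck eps n (lift2 M3)) by (intros; apply Ck_lift2_mult; auto using Ck_e1C).
  assert (C4 : forall n, Ck eps n (lift2 M4)) by (intros; apply Ck_lift2_mult; auto using Ck_TC, Ck_e1C).
  assert (C5 : forall n, Ck eps n (lift2 M5)) by (intros; apply Ck_lift2_mult; auto using Ck_TC).
  transitivity (torus_int (fun p q => k / 2 * second_var_integrand f p q +
    (k * (3 / 2) * e1C alpha_tt p q + (k * 3 * e1C M2 p q + (k * (7 / 2) * e1C M3 p q +
    (k * -3 * TC M4 p q + k * (3 / 2) * TC M5 p q)))))).
  { apply torus_int_ext; intros p q; rewrite second_t_divergence. unfold M2, M3, M4, M5, k. field. }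
  rewrite !(torus_int_plus eps) by auto 20 using Ck_lift2_plus, Ck_lift2_scal, Ck_e1C, Ck_TC, Ck_second_var, Ck_alpha_tt.
  rewrite !(torus_int_scal eps) by auto using Ck_e1C, Ck_TC, Ck_second_var, Ck_alpha_tt.
  rewrite (torus_int_e1C alpha_tt), (torus_int_e1C M2), (torus_int_e1C M3), (torus_int_TC M4), (torus_int_TC M5);
    auto using periodic_mult, periodic_e1C, periodic_TC, Ck_alpha_tt, periodic_alpha_tt.
  - ring.
  - now apply periodic_mult; [|apply periodic_TC].
  - now apply periodic_mult; [apply periodic_e1C|apply periodic_TC].
  - now apply periodic_mult; [|apply periodic_e1C].
  - now apply periodic_mult; apply periodic_TC.
Qed.

(** * Differentiating the energy twice *)

Lemma U_per t : Rabs t < eps -> periodic2 (U t).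
Proof. intros Ht; apply periodic_E1_integrand; auto. Qed.

Lemma energy_second_variation :
  (exists d, 0 < d /\ forall t, Rabs t < d -> ex_derive (fun s => E1_energy (F s)) t) /\
  is_derive (Derive (fun s => E1_energy (F s))) 0
    (sqrt 2 / 4 * torus_int (fun p q => second_var_integrand f p q * Rabs (ThetaE1 cliff p q))).
Proof.
  destruct (positive_near_0 eps U eps_pos (family_U 0) U_per) as [d [[Hd Hde] Hpos]].
  { intros p q; rewrite U_0; lra. }
  assert (shrink : forall n h, Ck eps n h -> Ck d n h) by (intros; now apply (Ck_shrink eps)).
  assert (Z : Rabs 0 < d) by now rewrite Rabs_R0.
  (* On this smaller slab u > 0, so |u|^(3/2) = u s with s = sqrt u smooth, and the energy is the
     integral of the smooth function [L]. *)
  pose (s := fun t p q => sqrt (U t p q)).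
  assert (Cs : forall n, Ck d n s) by (intros; apply Ck_sqrt; auto using family_U).
  pose (L := fun t p q => (U t p q * s t p q) * N t p q).
  assert (CU : forall n, Ck d n U) by auto using family_U.
  assert (CN : forall n, Ck d n N) by auto using family_N.
  assert (CUs : forall n, Ck d n (fun t p q => U t p q * s t p q)) by auto using Ck_mult.
  assert (CL : forall n, Ck d n L) by (intros; apply (Ck_mult d n (fun t p q => U t p q * s t p q)); auto).
  assert (EL : forall t, Rabs t < d -> torus_int (L t) = E1_energy (F t)).
  { intros t Ht; apply torus_int_ext; intros p q.
    pose proof (Hpos t p q Ht) as Up. pose proof (F_nonsing t p q ltac:(lra)) as Np.
    rewrite ThetaE1_N by lra. change (E1_integrand (F t) p q) with (U t p q).
    unfold L, s, pow32, N; rewrite (Rabs_right (U t p q)), (Rabs_right (vnorm _)) by lra. reflexivity. }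
  assert (D : forall t, Rabs t < d -> is_derive (fun t => E1_energy (F t)) t (torus_int (pd3 0 L t))).
  { intros t Ht; apply (is_derive_ext_loc (fun t => torus_int (L t))).
    - refine (filter_imp _ _ _ (slab_locally _ _ Ht)); exact EL.
    - now apply (is_derive_torus_int d). }
  split; [exists d; split; auto; intros t Ht; eexists; now apply D|].
  apply (is_derive_ext_loc (fun t => torus_int (pd3 0 L t))).
  { refine (filter_imp _ _ _ (slab_locally _ _ Z)); intros t Ht; symmetry.
    apply is_derive_unique; now apply D. }
  replace (sqrt 2 / 4 * _) with (torus_int (pd3 0 (pd3 0 L) 0)).
  { apply (is_derive_torus_int d); auto. now apply Ck_pd. }
  set (k := sqrt (/ 2)).
  assert (kk : k * k = / 2) by (apply sqrt_sqrt; lra).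
  assert (kp : 0 < k) by (apply sqrt_lt_R0; lra).
  assert (k2 : sqrt 2 = 2 * k).
  { replace 2 with ((2 * k) * (2 * k)) at 1 by nra. apply sqrt_square; lra. }
  (* The factor 1/2 is the value of N on the torus, by which [second_t] was divided. *)
  transitivity (torus_int (fun p q => / 2 * lift2 second_t 0 p q)).
  - apply torus_int_ext; intros p q.
    assert (s0 : s 0 p q = k) by (unfold s, k; now rewrite U_0).
    assert (ss : forall t p q, Rabs t < d -> U t p q = s t p q * s t p q).
    { intros t x y Ht; unfold s; rewrite sqrt_sqrt; auto. left; auto. }
    (* The derivatives of the root come from differentiating u = s^2. As 2 k^2 = 1, dividing by 2 k
       is multiplying by k. *)
    assert (s1 : pd3 0 s 0 p q = k * pd3 0 U 0 p q).
    { pose proof (pd3_mult d s s 0 0 p q (Cs 1%nat) (Cs 1%nat) Z) as M.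
      rewrite <- (pd3_ext d U) in M by auto. rewrite s0 in M. rewrite M.
      transitivity ((2 * (k * k)) * pd3 0 s 0 p q); [rewrite kk; field|ring]. }
    assert (s2 : pd3 0 (pd3 0 s) 0 p q = k * (pd3 0 (pd3 0 U) 0 p q - pd3 0 U 0 p q ^ 2)).
    { pose proof (pd3_mult_tt d s s 0 p q (Cs 2%nat) (Cs 2%nat) Z) as M.
      rewrite <- (pd3_ext d (pd3 0 U)) in M by (auto; intros; apply (pd3_ext d); auto).
      rewrite s0, s1 in M. rewrite M.
      transitivity (2 * (k * k) * pd3 0 (pd3 0 s) 0 p q + k * (2 * (k * k) - 1) * pd3 0 U 0 p q ^ 2);
        [rewrite kk; field|ring]. }
    unfold L.
    rewrite (pd3_mult_tt d (fun t p q => U t p q * s t p q)), (pd3_mult_tt d U), (pd3_mult d U) by auto.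
    rewrite s2, s1, s0, U_0, U_tt_0, U_t_0, N_tt_0, N_t_0, N_0.
    unfold lift2, second_t. fold k. field.
  - transitivity (/ 2 * torus_int second_t).
    { apply (torus_int_scal eps); auto; apply Ck_second_t. }
    rewrite torus_int_second. fold k. rewrite k2.
    transitivity (2 * k / 4 * (/ 2 * torus_int (second_var_integrand f))); [field|].
    f_equal. rewrite <- (torus_int_scal eps) by auto using Ck_second_var.
    apply torus_int_ext; intros p q. rewrite <- F_0, ThetaE1_N, N_0, Rabs_right by (auto; lra). ring.
Qed.

End Family.

Theorem theorem1p3 (eps : R) (F : R -> R -> R -> V4) (f g : R -> R -> R) :
  0 < eps ->
  (* smooth family of maps of the torus *)
  smooth3_on eps (fun t p q => v1 (F t p q)) ->
  smooth3_on eps (fun t p q => v2 (F t p q)) ->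
  smooth3_on eps (fun t p q => v3 (F t p q)) ->
  smooth3_on eps (fun t p q => v4 (F t p q)) ->
  (forall t, Rabs t < eps -> periodic2 (F t)) ->
  (* F_0 is the inclusion of the Clifford torus *)
  (forall p q, F 0 p q = cliff p q) ->
  (* each F_t is an immersion into S^3 without singular points *)
  (forall t p q, Rabs t < eps -> vnorm (F t p q) = 1) ->
  (forall t p q, Rabs t < eps -> forall a b : R,
      vadd (vscal a (Sp (F t) p q)) (vscal b (Sq (F t) p q)) = mkV 0 0 0 0 -> a = 0 /\ b = 0) ->
  (forall t p q, Rabs t < eps ->
      ~ (Theta (F t p q) (Sp (F t) p q) = 0 /\ Theta (F t p q) (Sq (F t) p q) = 0)) ->
  (* f, g smooth functions on the torus *)
  smooth2 f -> smooth2 g -> periodic2 f -> periodic2 g ->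
  (* variation field d/dt F_t = f e2 + g T *)
  (forall t p q, Rabs t < eps ->
      dvec (fun s => F s p q) t =
      vadd (vscal (f p q) (e2 (F t) p q)) (vscal (g p q) (Reeb (F t p q)))) ->
  (* conclusion: t |-> E_1(Sigma_t) is twice differentiable at 0 with the given value *)
  (exists d, 0 < d /\ forall t, Rabs t < d -> ex_derive (fun s => E1_energy (F s)) t) /\
  is_derive (Derive (fun s => E1_energy (F s))) 0
    (sqrt 2 / 4 * RInt (fun p => RInt (fun q =>
        second_var_integrand f p q * Rabs (ThetaE1 cliff p q)) 0 (2 * PI)) 0 (2 * PI)).
Proof.
  intros Heps S1 S2 S3 S4 Fper F0 Fsph Fimm Fns Sf Sg fper gper Fev.
  assert (Fs : forall n, VCk eps n F) by (intros n; repeat split; now apply smooth3_Ck).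
  apply (energy_second_variation eps F f g); auto using smooth2_Ck.
  - intros t p q Ht; now apply wvec_norm_pos; [apply Fimm|apply Fns].
  - do 2 (apply functional_extensionality; intros ?); apply F0.
Qed.
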